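(* Under the standing assumptions (1)–(6) in the context, suppose moreover that there exists a minimizing sequence $(h^n,\beta^n,\Lambda^n)$ for the dual problem (D) of the context such that $\{\beta^n\}$ is bounded in $\mathbb R$, $\{h^n\}$ is bounded in $\mathcal F_{\hat w}(S)$, and $\{\Lambda^n\}$ is bounded in the weak* topology on $\mathcal M([a,b])$. Then strong duality holds between the primal problem (P) and the dual problem (D) of the context: their optimal values are equal, and both problems attain their optimal values.
   Context: **MDP setting.** $S$ and $A$ are Borel spaces (Borel subsets of complete separable metric spaces). For each $s\in S$, $A(s)\in\mathcal B(A)$ is the set of feasible actions; $K=\{(s,a)\in S\times A: a\in A(s)\}$ is closed in $S\times A$. $Q(\cdot\mid s,a)$ is a transition law (stochastic kernel on $S$ given $K$); $r,z:K\to\mathbb R$ are measurable. $\mathcal P(\cdot)$ denotes Borel probability measures. With $H_0=S$, $H_t=K^t\times S$, $\Pi$ is the set of history-dependent randomized policies $\pi=(\pi_t)_{t\ge0}$, $\pi_t$ a stochastic kernel on $A$ given $H_t$ concentrated on $A(s_t)$. A policy $\pi$ and $\nu\in\mathcal P(S)$ determine a law $P_\nu^\pi$ (expectation $\mathbb E_\nu^\pi$) of the process $(s_t,a_t)_{t\ge0}$ with $s_0\sim\nu$. **Dominance constraint.** $(x)_-=\min\{x,0\}$. $Y$ is a real random variable with support in a compact interval $[a,b]$, and $y(\eta)=\mathbb E[(Y-\eta)_-]$. Put $$R(\pi,\nu)=\liminf_{T\to\infty}\tfrac1T\mathbb E_\nu^\pi\Big[\sum_{t=0}^{T-1}r(s_t,a_t)\Big],\qquad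 Z_\eta(\pi,\nu)=\liminf_{T\to\infty}\tfrac1T\mathbb E_\nu^\pi\Big[\sum_{t=0}^{T-1}(z(s_t,a_t)-\eta)_-\Big],$$ $\Delta=\{(\pi,\nu)\in\Pi\times\mathcal P(S): R(\pi,\nu)>-\infty,\ Z_\eta(\pi,\nu)\ge y(\eta)\ \forall\eta\in[a,b]\}$. **Spaces and operators.** Let $w=1-r$ on $K$ and $\hat w(s)=1-\sup_{a\in A(s)}r(s,a)$ on $S$. $\mathcal M_w(K)$ is the space of signed Borel measures $\mu$ on $K$ with $\int_K w\,d|\mu|<\infty$; $\mathcal F_w(K)$ is the space of measurable $h:K\to\mathbb R$ with $\|h\|=\sup_K|h|/w<\infty$; $\langle\mu,h\rangle=\int_K h\,d\mu$. $\mathcal F_{\hat w}(S)$ is defined analogously. $\mathcal M([a,b])$ is the space of finite signed Borel measures on $[a,b]$, the dual of $\mathcal C([a,b])$ via $\langle\Lambda,f\rangle=\int_a^b f\,d\Lambda$. $[L_0\mu](B)=\hat\mu(B)-\int_K Q(B\mid s,a)\mu(d(s,a))$ ($\hat\mu$ = marginal of $\mu$ on $S$); $[L_0^*h](s,a)=h(s)-\int_S h(\xi)Q(d\xi\mid s,a)$; $[L_1\mu](\eta)=\langle\mu,(z-\eta)_-\rangle$; $[L_1^*\Lambda](s,a)=\int_a^b(z(s,a)-\eta)_-\Lambda(d\eta)$. **Problems.** (P) maximize $\langle\mu,r\rangle$ subject to $L_0\mu=0$, $\langle\mu,1\rangle=1$, $L_1\mu\ge y$, $\mu\in\mathcal M_w(K)$,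 $\mu\ge0$. (D) minimize $\beta-\langle\Lambda,y\rangle$ subject to $r+L_0^*h-\beta\,1+L_1^*\Lambda\le0$ on $K$, $(h,\beta,\Lambda)\in\mathcal F_{\hat w}(S)\times\mathbb R\times\mathcal M([a,b])$, $\Lambda\ge0$. A minimizing sequence for (D) is a sequence of feasible points whose objective values converge to the infimum. **Standing assumptions.** (1) $\Delta\ne\emptyset$. (2) $r\le0$ and for every $\epsilon\ge0$ the set $\{(s,a)\in K: r(s,a)\ge-\epsilon\}$ is compact. (3) $z$ is bounded and upper semicontinuous on $K$. (4) $Q$ is weakly continuous: $\int_S h(\xi)Q(d\xi\mid\cdot)$ is bounded continuous on $K$ for every bounded continuous $h$ on $S$. (5) $(z-\eta)_-\in\mathcal F_w(K)$ for all $\eta\in[a,b]$. (6) $\int_S\hat w(\xi)Q(d\xi\mid\cdot)\in\mathcal F_w(K)$. *)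

(* Defs.v *)
From HB Require Import structures.
From mathcomp Require Import all_boot all_order all_algebra.
From mathcomp Require Import all_classical all_reals all_analysis.
From mathcomp Require Import measurable_realfun.

Set Implicit Arguments.
Unset Strict Implicit.
Unset Printing Implicit Defensive.
Import Order.TTheory GRing.Theory Num.Theory.
Import numFieldNormedType.Exports.

Local Open Scope classical_set_scope.
Local Open Scope ring_scope.

Definition separable (T : topologicalType) :=
  exists D : set T, countable D /\ dense D.

(* A Borel space is a topological space homeomorphic to a Borel subset of a
   complete separable metric space, equipped with its Borel sigma-algebra. *)
HB.mixin Record isBorelSpace (R : realType) (d : measure_display) T
    & Topological T & Measurable d T := {
  borel_measurable : @measurable d T = <<s @open T >> ;
  borel_embedding : exists (X : completePseudoMetricType R) (f : T -> X),
    [/\ hausdorff_space X, separable X, injective f,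
        (forall U : set T, open U <-> exists2 V, open V & U = f @^-1` V) &
        <<s @open X >> (range f)] }.

#[short(type="borelSpaceType")]
HB.structure Definition BorelSpace (R : realType) (d : measure_display) :=
  { T of Topological T & Measurable d T & isBorelSpace R d T }.

Section Functions.
Context {R : realType}.

(* The convention is (x)_- = min(x, 0), so [negpart x] is nonpositive. *)
Definition negpart (x : R) : R := Num.min x 0.

Definition upper_semicontinuous_on (T : topologicalType) (D : set T)
    (f : T -> R) :=
  forall x c, D x -> f x < c -> \forall y \near within D (nbhs x), f y < c.

Definition bounded_on (T : Type) (D : set T) (f : T -> R) :=
  exists C, forall x, D x -> `|f x| <= C.

Definition wnorm (T : Type) (D : set T) (w h : T -> R) : \bar R :=
  ereal_sup [set (`|h x| / w x)%:E | x in D].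

(* The weighted space F_w(D); values outside of D are irrelevant. *)
Definition Fspace d (T : measurableType d) (D : set T) (w h : T -> R) :
    Prop :=
  measurable_fun D h /\ (wnorm D w h < +oo)%E.

End Functions.

Section SignedMeasures.
Context {R : realType} d {T : measurableType d}.
Implicit Types nu : {charge set T -> \bar R}.

(* Any choice will do: Hahn decompositions are unique up to null sets
   (Hahn_decomposition_uniq). *)
Definition hahnP nu :=
  projT2 (cid (projT2 (cid (Hahn_decomposition nu)))).

Definition total_variation nu : {measure set T -> \bar R} :=
  charge_variation (hahnP nu).

Definition cintegral nu (D : set T) (f : T -> R) : R :=
  \int[jordan_pos (hahnP nu)]_(x in D) f x
  - \int[jordan_neg (hahnP nu)]_(x in D) f x.

(* Signed measures on a measurable subset D of T are identified with the signed
   measures on T that vanish outside of D. *)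
Definition carried_by nu (D : set T) :=
  forall B, measurable B -> B `&` D = set0 -> nu B = 0%E.

Definition charge_ge0 nu := forall B, measurable B -> (0 <= nu B)%E.

(* M_w(D) *)
Definition Mspace (D : set T) (w : T -> R) nu : Prop :=
  carried_by nu D /\ (\int[total_variation nu]_(x in D) (w x)%:E < +oo)%E.

End SignedMeasures.

(* M([a,b]) *)
Definition Mitv {R : realType} (a b : R) (L : {charge set R -> \bar R}) : Prop :=
  carried_by L `[a, b].

(* The weak* topology on M([a,b]) is generated by the seminorms |<., f>| with
   f in C([a,b]); a set is bounded iff each of these seminorms is bounded. *)
Definition weak_star_bounded {R : realType} (a b : R)
    (L : nat -> {charge set R -> \bar R}) :=
  forall f : R -> R, {within `[a, b], continuous f} ->
    exists C, forall n, `|cintegral (L n) `[a, b] f| <= C.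

(* Functions and kernels on K are given as total functions on S * A of which
   only the restriction to K is constrained and used. *)
Record mdp (R : realType) dS dA (S : borelSpaceType R dS)
    (A : borelSpaceType R dA) := MDP {
  feas : S -> set A ;
  K := [set x : S * A | feas x.1 x.2] ;
  feas_measurable : forall s, measurable (feas s) ;
  K_closed : closed K ;
  Q : S * A -> probability S R ;
  Q_measurable : forall B, measurable B -> measurable_fun K (fun x => Q x B) ;
  rew : S * A -> R ;
  rew_measurable : measurable_fun K rew ;
  zf : S * A -> R ;
  zf_measurable : measurable_fun K zf }.

(* The space T^nat carries the sigma-algebra generated by the coordinates. *)
Definition cylinders d (T : measurableType d) : set (set (nat -> T)) :=
  [set C | exists (n : nat) (B : set T),
     measurable B /\ C = (fun om => om n) @^-1` B].

Definition trajectories d (T : measurableType d) :=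
  g_sigma_algebraType (@cylinders d T).

Section Processes.
Context {R : realType} {dS dA} {S : borelSpaceType R dS}
  {A : borelSpaceType R dA} (M : mdp S A).

(* H_t = K^t * S, as a subset of (S * A)^t * S *)
Definition Hist (t : nat) : set (t.-tuple (S * A) * S) :=
  [set h | forall i, K M (tnth h.1 i)].
Arguments Hist : clear implicits.

Record policy := Policy {
  pol : forall t : nat, t.-tuple (S * A) * S -> probability A R ;
  pol_measurable : forall t C, measurable C ->
    measurable_fun (Hist t) (fun h => pol h C) ;
  pol_feas : forall t (h : t.-tuple (S * A) * S), Hist t h ->
    pol h (feas M h.2) = 1%E }.

Local Notation Omega := (trajectories (S * A)%type).

Definition prefix_at (t : nat) (om : Omega) : t.-tuple (S * A) :=
  [tuple om i | i < t].

Definition hist_at (t : nat) (om : Omega) : t.-tuple (S * A) * S :=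
  (prefix_at t om, (om t).1).

Definition Kinf : set Omega := [set om | forall t, K M (om t)].

(* P is the law P_nu^pi of the process (s_t, a_t)_t; the last two clauses say
   that pi_t and Q are the conditional laws of a_t given h_t and of s_{t+1}
   given (h_t, a_t). *)
Record is_law (pi : policy) (nu : probability S R) (P : probability Omega R) :
    Prop := IsLaw {
  law_K : P Kinf = 1%E ;
  law_init : forall B : set S, measurable B ->
    P [set om | B (om 0%N).1] = nu B ;
  law_action : forall t (D : set (t.-tuple (S * A) * S)) (C : set A),
    measurable D -> D `<=` Hist t -> measurable C ->
    P [set om | D (hist_at t om) /\ C (om t).2]
    = (\int[P]_(om in hist_at t @^-1` D) pol pi (hist_at t om) C)%E ;
  law_state : forall t (D : set (t.+1.-tuple (S * A))) (B : set S),
    measurable D -> D `<=` [set p | forall i, K M (tnth p i)] -> measurable B ->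
    P [set om | D (prefix_at t.+1 om) /\ B (om t.+1).1]
    = (\int[P]_(om in prefix_at t.+1 @^-1` D) Q M (om t) B)%E }.

(* liminf_T 1/T E [sum_(t < T) c (s_t, a_t)]; the term T = 0 is irrelevant. *)
Definition liminf_average (P : probability Omega R) (c : S * A -> R) : \bar R :=
  limn_einf (fun T : nat =>
    (T%:R^-1)%:E * \int[P]_(om in Kinf) (\sum_(t < T) c (om t))%:E)%E.

(* y is the function eta |-> E[(Y - eta)_-]. *)
Definition Delta (a b : R) (y : R -> R) : set (policy * probability S R) :=
  [set pn | exists P : probability Omega R,
     [/\ is_law pn.1 pn.2 P,
         (-oo < liminf_average P (rew M))%E &
         forall eta, a <= eta <= b ->
           ((y eta)%:E <= liminf_average P (fun x => negpart (zf M x - eta)))%E]].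

End Processes.
Arguments Delta {R dS dA S A} M a b y.

(* y(eta) = E[(Y - eta)_-] *)
Definition benchmark {R : realType} d (Om : measurableType d)
    (P : probability Om R) (Y : {RV P >-> R}) (eta : R) : R :=
  \int[P]_om negpart (Y om - eta).

Record dual_point (R : realType) dS (S : borelSpaceType R dS) := DualPoint {
  dp_h : S -> R ;
  dp_beta : R ;
  dp_Lambda : {charge set R -> \bar R} }.

Section LinearPrograms.
Context {R : realType} {dS dA} {S : borelSpaceType R dS}
  {A : borelSpaceType R dA} (M : mdp S A).
Implicit Types (mu : {charge set (S * A)%type -> \bar R})
  (L : {charge set R -> \bar R}) (h : S -> R) (x : S * A).

Definition weight x : R := 1 - rew M x.

Definition what (s : S) : R := 1 - sup [set rew M (s, c) | c in feas M s].

(* <mu, f> *)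
Definition pairing mu (f : S * A -> R) : R := cintegral mu (K M) f.

Definition L0 mu (B : set S) : R :=
  fine (mu (fst @^-1` B)) - pairing mu (fun x => fine (Q M x B)).

Definition L0star h x : R := h x.1 - \int[Q M x]_xi h xi.

Definition L1 mu (eta : R) : R := pairing mu (fun x => negpart (zf M x - eta)).

Definition L1star (a b : R) L x : R :=
  cintegral L `[a, b] (fun eta => negpart (zf M x - eta)).

Variables (a b : R) (y : R -> R).

Definition primal_feasible mu : Prop :=
  [/\ Mspace (K M) weight mu, charge_ge0 mu,
      (forall B, measurable B -> L0 mu B = 0),
      pairing mu (fun=> 1) = 1 &
      forall eta, a <= eta <= b -> y eta <= L1 mu eta].

Definition primal_objective mu : R := pairing mu (rew M).

Definition primal_value : \bar R :=
  ereal_sup [set (primal_objective mu)%:E | mu in primal_feasible].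

Definition dual_feasible (u : dual_point S) : Prop :=
  [/\ Fspace setT what (dp_h u), Mitv a b (dp_Lambda u),
      charge_ge0 (dp_Lambda u) &
      forall x, K M x ->
        rew M x + L0star (dp_h u) x - dp_beta u + L1star a b (dp_Lambda u) x
        <= 0].

Definition dual_objective (u : dual_point S) : R :=
  dp_beta u - cintegral (dp_Lambda u) `[a, b] y.

Definition dual_value : \bar R :=
  ereal_inf [set (dual_objective u)%:E | u in dual_feasible].

Definition minimizing_sequence (u : nat -> dual_point S) : Prop :=
  (forall n, dual_feasible (u n)) /\
  (fun n => (dual_objective (u n))%:E) @ \oo --> dual_value.

Record standing_assumptions : Prop := StandingAssumptions {
  Delta_nonempty : Delta M a b y !=set0 ;
  rew_le0 : forall x, K M x -> rew M x <= 0 ;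
  rew_compact : forall e, 0 <= e ->
    compact [set x | K M x /\ - e <= rew M x] ;
  zf_bounded : bounded_on (K M) (zf M) ;
  zf_usc : upper_semicontinuous_on (K M) (zf M) ;
  Q_weakly_continuous : forall h : S -> R, continuous h ->
    bounded_on setT h ->
    let Qh x := \int[Q M x]_xi h xi in
    bounded_on (K M) Qh /\ {within K M, continuous Qh} ;
  zf_Fspace : forall eta, a <= eta <= b ->
    Fspace (K M) weight (fun x => negpart (zf M x - eta)) ;
  (* Integrability is stated since \int is real valued, hence total. *)
  Q_what_integrable : forall x, K M x ->
    (Q M x).-integrable setT (EFin \o what) ;
  Q_what_Fspace : Fspace (K M) weight (fun x => \int[Q M x]_xi what xi) }.

End LinearPrograms.

(* Main.v *)
(* Weak duality follows by integrating the dual inequality against a feasible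
   measure and exchanging the two integrals. Let d be the dual value.

   Primal attainment: the functions t (r - d) + L_0^* h + sum_i p_i ((z - eta_i)_- - y(eta_i)) with
   t, p_i >= 0 and h bounded continuous form a convex cone. None of them is
   bounded above on K by a negative constant, since normalizing it would give a
   dual feasible point of value less than d. By Hahn-Banach there is a
   normalized positive functional l on the bounded functions on K that is
   nonnegative on the cone. Since the superlevel sets of r are compact, l is
   tight, and therefore dominated on closed sets by a Borel probability mu. The
   functions r and (z - eta)_- are upper semicontinuous, so mu inherits the
   inequalities satisfied by l: it is primal feasible with value at least d.

   Dual attainment: along a subsequence of the minimizing sequence, beta^n and
   the integrals against Lambda^n of 1, of y and of (q - .)_- for rational q
   converge. A measure Lambda with the limits as integrals exists by the same
   Hahn-Banach argument on [a, b], and h = limsup h^n satisfies the dual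
   inequality by Fatou's lemma, as |h^n| is bounded by the integrable C w. *)

Require Import Defs.
From HB Require Import structures.
From mathcomp Require Import all_boot all_order all_algebra.
From mathcomp Require Import all_classical all_reals all_analysis.
From mathcomp Require Import measurable_realfun ring lra.

Set Implicit Arguments.
Unset Strict Implicit.
Unset Printing Implicit Defensive.
Import Order.TTheory GRing.Theory Num.Theory.
Import numFieldNormedType.Exports.
Local Open Scope classical_set_scope.
Local Open Scope ring_scope.

(** * Hahn-Banach *)

(** A positive functional on bounded functions is a priori only finitely additive, and S * A need
    not be locally compact, so it is not automatically given by a measure. Passing to a measure can
    only increase the mass of closed sets, which is the favourable direction for functions with
    closed superlevel sets. The balance equation, an equality, therefore has to come from continuous
    test functions h and - h. Since r may be unbounded below, cone elements may lie outside the
    domain of l; they act through the bounded functions above them, and r is recovered from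
    truncations by monotone convergence.

    On the dual side, bounded sets of functions h carry no sequential compactness, as S may be
    uncountable. But the dual inequality bounds h(s) by an integral of h, a direction that limsup
    preserves by the reverse Fatou lemma. A diagonal argument follows only countably many integrals
    against Lambda^n; monotonicity and Lipschitz continuity in t of the integral of (t - eta)_-
    extend the result from rational t to all values of z. *)

Section HahnBanach.
Context {R : realType} {V : lmodType R}.
Implicit Types (D : set V) (p q : V -> R).

Definition subspace_set D :=
  [/\ D 0, (forall u v, D u -> D v -> D (u + v)) &
      (forall c u, D u -> D (c *: u))].

Definition sublinear_on D p :=
  (forall u v, D u -> D v -> p (u + v) <= p u + p v) /\
  (forall c u, 0 <= c -> D u -> p (c *: u) = c * p u).

Lemma sublinear_on0 D p : subspace_set D -> sublinear_on D p -> p 0 = 0.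
Proof. by move=> [D0 _ _] [_ /(_ 0 0 (lexx _) D0)]; rewrite scale0r mul0r. Qed.

Lemma sublinear_onN D p u : subspace_set D -> sublinear_on D p -> D u ->
  - p (- u) <= p u.
Proof.
move=> DV pD Du; have [D0 DD DZ] := DV; have [pA _] := pD.
have DNu : D (- u) by rewrite -scaleN1r; exact: DZ.
have := pA _ _ Du DNu; rewrite subrr (sublinear_on0 DV pD); lra.
Qed.

(** The witness is the pointwise infimum, finite because every member lies above [- p (- u)]. It is
    subadditive because two members nearly optimal at u and at v are comparable, so the smaller one
    is nearly optimal at both. *)
Lemma sublinear_on_chain D (F : set (V -> R)) (q0 p : V -> R) :
  subspace_set D -> F q0 ->
  (forall q, F q -> sublinear_on D q /\ forall u, D u -> q u <= p u) ->
  (forall q1 q2, F q1 -> F q2 ->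
     (forall u, D u -> q1 u <= q2 u) \/ (forall u, D u -> q2 u <= q1 u)) ->
  exists q, sublinear_on D q /\
    forall q', F q' -> forall u, D u -> q u <= q' u.
Proof.
move=> DV Fq0 Fp Ftot; have [D0 DD DZ] := DV.
pose E u := [set q u | q in F].
have E0 u : E u !=set0 by exists (q0 u), q0.
have Elb u : D u -> lbound (E u) (- p (- u)).
  move=> Du _ [q Fq <-]; have [qD qp] := Fp _ Fq.
  have DNu : D (- u) by rewrite -scaleN1r; exact: DZ.
  by apply: le_trans (sublinear_onN DV qD Du); rewrite lerN2; exact: qp.
have hE u : D u -> has_lbound (E u) by move=> Du; exists (- p (- u)); exact: Elb.
have infle q u : F q -> D u -> inf (E u) <= q u.
  by move=> Fq Du; apply: ge_inf; [exact: hE|exists q].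
have infZ c u : 0 <= c -> D u -> c * inf (E u) <= inf (E (c *: u)).
  move=> c0 Du; apply: lb_le_inf => // _ [q Fq <-].
  have [[_ qZ] _] := Fp _ Fq; rewrite qZ//.
  by rewrite ler_wpM2l// infle.
exists (fun u => inf (E u)); split; last by move=> q' Fq' u Du; exact: infle.
split=> [u v Du Dv|c u c0 Du].
- apply/ler_addgt0Pr => e e0.
  have e2 : 0 < e / 2 by rewrite divr_gt0.
  have [_ [q1 Fq1 <-] h1] := inf_adherent e2 (conj (E0 u) (hE _ Du)).
  have [_ [q2 Fq2 <-] h2] := inf_adherent e2 (conj (E0 v) (hE _ Dv)).
  have [[q1A _] _] := Fp _ Fq1; have [[q2A _] _] := Fp _ Fq2.
  have [h|h] := Ftot _ _ Fq1 Fq2.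
  + have := infle _ _ Fq1 (DD _ _ Du Dv); have := q1A _ _ Du Dv; have := h _ Dv.
    lra.
  + have := infle _ _ Fq2 (DD _ _ Du Dv); have := q2A _ _ Du Dv; have := h _ Du.
    lra.
- apply/eqP; rewrite eq_le infZ// andbT.
  move: c0; rewrite [X in is_true X -> _]le_eqVlt => /predU1P[<-|c0].
    rewrite mul0r scale0r; apply: le_trans (infle _ _ Fq0 D0) _.
    by have [qD _] := Fp _ Fq0; rewrite (sublinear_on0 DV qD).
  have := infZ c^-1 (c *: u); rewrite invr_ge0 (ltW c0) => /(_ isT (DZ _ _ Du)).
  by rewrite scalerA mulVf ?gt_eqF// scale1r ler_pdivrMl.
Qed.

(* Moving q along x: [q_x v = inf_(t >= 0) (q (v + t x) - t q x)] is sublinear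
   and below q, so minimality of q forces [q v + q x <= q (v + x)]. *)
Lemma sublinear_on_shift D q x : subspace_set D -> sublinear_on D q -> D x ->
  exists q', [/\ sublinear_on D q', (forall v, D v -> q' v <= q v) &
    forall v, D v -> q' v <= q (v + x) - q x].
Proof.
move=> DV qD Dx; have [D0 DD DZ] := DV; have [qA qZ] := qD.
pose E v := [set q (v + t *: x) - t * q x | t in [set t | 0 <= t]].
have E0 v : E v !=set0.
  by exists (q (v + 0 *: x) - 0 * q x), 0 => //=.
have Elb v : D v -> lbound (E v) (- q (- v)).
  move=> Dv _ [t /= t0 <-].
  have DNv : D (- v) by rewrite -scaleN1r; exact: DZ.
  have := qA _ _ (DD _ _ Dv (DZ t _ Dx)) DNv.
  by rewrite addrAC subrr add0r qZ//; lra.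
have hE v : D v -> has_lbound (E v) by move=> Dv; exists (- q (- v)); exact: Elb.
have infle v t : D v -> 0 <= t -> inf (E v) <= q (v + t *: x) - t * q x.
  by move=> Dv t0; apply: ge_inf; [exact: hE|exists t].
have infZ c v : 0 < c -> D v -> c * inf (E v) <= inf (E (c *: v)).
  move=> c0 Dv; apply: lb_le_inf => // _ [t /= t0 <-].
  rewrite -ler_pdivlMl//; apply: le_trans (infle _ (c^-1 * t) Dv _) _.
    by rewrite mulr_ge0// invr_ge0 ltW.
  have Dct : D (c *: v + t *: x) by apply: DD; exact: DZ.
  rewrite mulrBr -(qZ c^-1 (_ + _)) ?invr_ge0 ?(ltW c0)//.
  by rewrite scalerDr !scalerA mulVf ?gt_eqF// scale1r mulrA.
have inf0 : inf (E 0) = 0.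
  apply/eqP; rewrite eq_le; apply/andP; split.
    have := infle 0 0 D0 (lexx _).
    by rewrite scale0r mul0r addr0 (sublinear_on0 DV qD) subrr.
  apply: lb_le_inf => // y /Elb -/(_ D0).
  by rewrite oppr0 (sublinear_on0 DV qD) oppr0.
exists (fun v => inf (E v)); split; last 2 first.
- move=> v Dv; have := infle v 0 Dv (lexx _).
  by rewrite scale0r mul0r addr0 subr0.
- by move=> v Dv; have := infle v 1 Dv ler01; rewrite scale1r mul1r.
split=> [u v Du Dv|c u].
- apply/ler_addgt0Pr => e e0.
  have e2 : 0 < e / 2 by rewrite divr_gt0.
  have [_ [t /= t0 <-] ht] := inf_adherent e2 (conj (E0 u) (hE _ Du)).
  have [_ [s /= s0 <-] hs] := inf_adherent e2 (conj (E0 v) (hE _ Dv)).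
  have := infle (u + v) (t + s) (DD _ _ Du Dv) (addr_ge0 t0 s0).
  have := qA _ _ (DD _ _ Du (DZ t _ Dx)) (DD _ _ Dv (DZ s _ Dx)).
  rewrite addrACA -scalerDl; lra.
- rewrite [X in is_true X -> _]le_eqVlt => /predU1P[<- _|c0 Du].
    by rewrite scale0r mul0r.
  apply/eqP; rewrite eq_le infZ// andbT.
  rewrite -ler_pdivrMl//.
  have := infZ c^-1 (c *: u); rewrite invr_gt0 => /(_ c0 (DZ _ _ Du)).
  by rewrite scalerA mulVf ?gt_eqF// scale1r.
Qed.

(** Linear functionals are the minimal sublinear ones: Zorn's lemma gives a minimal q below p, and
    [sublinear_on_shift] makes it additive. The subspace D will be that of the bounded functions, on
    which p is meaningful. *)
Lemma hahn_banach D p : subspace_set D -> sublinear_on D p ->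
  exists l : V -> R, [/\ (forall u, D u -> l u <= p u),
    (forall u v, D u -> D v -> l (u + v) = l u + l v) &
    (forall c u, D u -> l (c *: u) = c * l u)].
Proof.
move=> DV pD; have [D0 DD DZ] := DV.
pose T := {q : V -> R | sublinear_on D q /\ forall u, D u -> q u <= p u}.
(* The order is reversed, so that a maximal element is a minimal functional. *)
pose Rel (s t : T) := `[< forall u, D u -> sval t u <= sval s u >].
have tp : T by exists p.
have [||F Ftot|[q [qD qp]] qmin] := @ZL_preorder T tp Rel.
- by move=> t; apply/asboolP.
- move=> r s t /asboolP rs /asboolP st; apply/asboolP => u Du.
  exact: le_trans (st _ Du) (rs _ Du).
- have [[t0 Ft0]|F0] := pselect (exists t0, F t0); last first.
    by exists tp => s Fs; exfalso; apply: F0; exists s.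
  have [|||q [qD qF]] :=
      @sublinear_on_chain D [set sval s | s in F] (sval t0) p DV.
  + by exists t0.
  + by move=> _ [s _ <-]; exact: (svalP s).
  + move=> _ _ [s Fs <-] [t Ft <-].
    by have [/asboolP h|/asboolP h] := Ftot _ _ Fs Ft; [right|left].
  have qp u : D u -> q u <= p u.
    move=> Du; apply: le_trans (qF (sval t0) _ u Du) _; first by exists t0.
    by have [_] := svalP t0; exact.
  exists (exist _ q (conj qD qp)) => s Fs; apply/asboolP => u Du /=.
  by apply: qF => //; exists s.
have [qA qZ] := qD.
have add u v : D u -> D v -> q (u + v) = q u + q v.
  move=> Du Dv; apply/eqP; rewrite eq_le qA//=.
  have [q' [q'D q'q q'v]] := sublinear_on_shift DV qD Dv.
  have q'p w : D w -> q' w <= p w by move=> Dw; exact: le_trans (q'q _ Dw) (qp _ Dw).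
  have /asboolP/(_ _ Du)/= := qmin (exist _ q' (conj q'D q'p)) (asboolT q'q).
  by have := q'v _ Du; lra.
exists q; split=> // c u Du; have [c0|c0] := leP 0 c; first exact: qZ.
have := add _ _ (DZ (- c) _ Du) (DZ c _ Du).
rewrite -scalerDl addNr scale0r (sublinear_on0 DV qD) qZ//; first lra.
by rewrite oppr_ge0 ltW.
Qed.

End HahnBanach.

(** * Positive functionals that are nonnegative on a convex cone *)

Section PositiveFunctional.
Context {R : realType} {T : Type}.
Implicit Types (K : set T) (G : set (T -> R)) (f g : T -> R).

Definition convex_cone G :=
  [/\ G (fun=> 0), (forall f g, G f -> G g -> G (fun x => f x + g x)) &
      (forall c f, 0 <= c -> G f -> G (fun x => c * f x))].

Lemma bounded_on_cst K (c : R) : bounded_on K (fun=> c). Proof. by exists `|c|. Qed.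

Lemma bounded_on_indic K A : bounded_on K (\1_A : T -> R).
Proof. by exists 1 => x _; rewrite indicE; case: (x \in A); rewrite ?normr1 ?normr0. Qed.

Lemma bounded_onD K f g : bounded_on K f -> bounded_on K g ->
  bounded_on K (fun x => f x + g x).
Proof.
move=> [C fC] [C' gC]; exists (C + C') => x Kx.
by rewrite (le_trans (ler_normD _ _))// lerD ?fC ?gC.
Qed.

Lemma bounded_onZ K c f : bounded_on K f -> bounded_on K (fun x => c * f x).
Proof.
by move=> [C fC]; exists (`|c| * C) => x Kx; rewrite normrM ler_wpM2l ?fC.
Qed.

(** In substance, integration against a finitely additive probability on all subsets of K;
    positivity makes values outside K irrelevant. *)
Record positive_functional K (l : (T -> R) -> R) : Prop := PositiveFunctional {
  pfD : forall f g, bounded_on K f -> bounded_on K g ->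
    l (fun x => f x + g x) = l f + l g ;
  pfZ : forall c f, bounded_on K f -> l (fun x => c * f x) = c * l f ;
  pf_ge0 : forall f, bounded_on K f -> (forall x, K x -> 0 <= f x) -> 0 <= l f ;
  pf1 : l (fun=> 1) = 1 }.

Implicit Type l : (T -> R) -> R.

Lemma pf_le K l f g : positive_functional K l -> bounded_on K f -> bounded_on K g ->
  (forall x, K x -> f x <= g x) -> l f <= l g.
Proof.
move=> pl bf bg fg; rewrite -subr_ge0 -mulN1r -(pfZ pl)// -(pfD pl)//; last exact: bounded_onZ.
apply: (pf_ge0 pl); first by apply: bounded_onD => //; exact: bounded_onZ.
by move=> x Kx; rewrite mulN1r subr_ge0 fg.
Qed.

Lemma pf_cst K l c : positive_functional K l -> l (fun=> c) = c.
Proof.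
move=> pl; rewrite -[RHS]mulr1 -(pf1 pl) -(pfZ pl); last exact: bounded_on_cst.
by congr l; apply/funext => x; rewrite mulr1.
Qed.

(* Hahn-Banach applied to the sublinear functional
   [p f = inf {c | f + g <= c on K for some g in G}]. *)
Lemma cone_positive_functional K G : convex_cone G ->
  (forall g (e : R), G g -> 0 < e -> ~ (forall x, K x -> g x <= - e)) ->
  exists2 l, positive_functional K l &
    forall f g, bounded_on K f -> G g -> (forall x, K x -> g x <= f x) -> 0 <= l f.
Proof.
move=> [G0 GD GZ] Gneg.
pose E f := [set c : R | exists2 g, G g & forall x, K x -> f x + g x <= c].
pose p f := inf (E f).
have EP f C : (forall x, K x -> f x <= C) -> E f C.
  by move=> fC; exists (fun=> 0) => // x Kx; rewrite addr0 fC.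
have E0 f : bounded_on K f -> E f !=set0.
  move=> [C fC]; exists C; apply: EP => x Kx.
  by apply: le_trans (fC _ Kx); exact: ler_norm.
(* The hypothesis on G keeps p finite: C <= f and f + g <= c < C would give g <= - (C - c). *)
have Elb f C : (forall x, K x -> C <= f x) -> lbound (E f) C.
  move=> fC c [g Gg fgc]; rewrite leNgt; apply/negP => cC.
  apply: (Gneg g (C - c) Gg); first by rewrite subr_gt0.
  by move=> x Kx; have := fC _ Kx; have := fgc _ Kx; lra.
have hE f : bounded_on K f -> has_lbound (E f).
  move=> [C fC]; exists (- C); apply: Elb => x Kx.
  by have := fC _ Kx; rewrite ler_norml => /andP[].
have p_le f c : bounded_on K f -> E f c -> p f <= c.
  by move=> bf Efc; apply: ge_inf => //; exact: hE.
have p_ge f C : bounded_on K f -> (forall x, K x -> C <= f x) -> C <= p f.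
  by move=> bf fC; apply: lb_le_inf; [exact: E0|exact: Elb].
pose D : set (T -> R^o) := [set f | bounded_on K f].
have DV : subspace_set D.
  split; [exact: (bounded_on_cst K 0)|exact: bounded_onD|].
  by move=> c u; exact: bounded_onZ.
have pZ c f : 0 < c -> bounded_on K f -> c * p f <= p (fun x => c * f x).
  move=> c0 bf; apply: lb_le_inf; first exact/E0/bounded_onZ.
  move=> d [g Gg fg]; rewrite -ler_pdivlMl//; apply: p_le => //.
  exists (fun x => c^-1 * g x); first by apply: GZ => //; rewrite invr_ge0 ltW.
  by move=> x Kx; rewrite ler_pdivlMl// mulrDr mulrA mulfV ?gt_eqF// mul1r fg.
have pD : sublinear_on D (p : (T -> R^o) -> R).
  split=> [u v Du Dv|c u].
  - apply/ler_addgt0Pr => e e0.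
    have e2 : 0 < e / 2 by rewrite divr_gt0.
    have [c [g Gg gc] hc] := inf_adherent e2 (conj (E0 _ Du) (hE _ Du)).
    have [d [h Gh hd] hd'] := inf_adherent e2 (conj (E0 _ Dv) (hE _ Dv)).
    have : p (u + v) <= c + d.
      apply: p_le; first exact: bounded_onD.
      exists (fun x => g x + h x); first exact: GD.
      by move=> x Kx; rewrite addrACA lerD ?gc ?hd.
    by rewrite /p; lra.
  - rewrite [X in is_true X -> _]le_eqVlt => /predU1P[<- Du|c0 Du].
      rewrite mul0r scale0r; apply/eqP; rewrite eq_le; apply/andP; split.
      + by apply: p_le; [exact: (bounded_on_cst K 0)|apply: EP].
      + by apply: p_ge => //; exact: (bounded_on_cst K 0).
    apply/eqP; rewrite eq_le; apply/andP; split; last exact: pZ.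
    rewrite -ler_pdivrMl//.
    have := pZ c^-1 (c *: u : T -> R); rewrite invr_gt0 => /(_ c0 (bounded_onZ c Du)).
    move=> /le_trans; apply; rewrite le_eqVlt; apply/orP; left; apply/eqP.
    by congr p; apply/funext => x; rewrite mulrA mulVf ?gt_eqF// mul1r.
have [l [lp lD lZ]] := hahn_banach DV pD.
(* Since - f + g <= 0 on K, p (- f) <= 0. The element g may be unbounded below, so only bounded
   functions above it are evaluated. *)
have l_ge0 f g : bounded_on K f -> G g -> (forall x, K x -> g x <= f x) -> 0 <= l f.
  move=> bf Gg gf; rewrite -oppr_le0 -mulN1r -lZ//.
  apply: le_trans (lp _ _) _; first exact: bounded_onZ.
  apply: p_le; first exact: (bounded_onZ (-1) bf).
  exists g => // x Kx; change (-1 * f x + g x <= 0).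
  by rewrite mulN1r addrC subr_le0 gf.
exists l => //; split.
- by move=> f g bf bg; exact: lD.
- by move=> c f bf; exact: lZ.
- by move=> f bf f0; apply: (l_ge0 f (fun=> 0)).
- apply/eqP; rewrite eq_le; apply/andP; split.
    apply: le_trans (lp _ _) _; first exact: (bounded_on_cst K 1).
    by apply: p_le; [exact: (bounded_on_cst K 1)|apply: EP].
  have b1 := bounded_onZ (-1) (bounded_on_cst K 1).
  have : l (-1 *: (fun=> 1)) <= -1.
    apply: le_trans (lp _ b1) _; apply: p_le => //.
    by apply: EP => x _; change (-1 * 1 <= -1 :> R); rewrite mulr1.
  by rewrite lZ ?mulN1r ?lerN2//; exact: (bounded_on_cst K 1).
Qed.

End PositiveFunctional.

(** * Separation of compact sets in Hausdorff spaces *)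

Section CompactSeparation.
Context {T : topologicalType}.
Implicit Types A B C U V : set T.

(** Compactness reduces to finitely many members of F, whose intersection is again in F. Used with F
    the neighbourhood filter of a point, then of a compact set. *)
Lemma compact_filter_separation A (F : set_system T) : Filter F -> compact A ->
  (forall x, A x -> exists2 V, F V & nbhs x (~` V)) ->
  exists2 V, F V & A `<=` (~` V)°.
Proof.
move=> FF /compact_near_coveringP Ac AF.
have [F0|nF0] := pselect (F set0).
  exists set0 => // x _; rewrite setC0; exact: filterT.
have {}FF : ProperFilter F by split.
have PF := powerset_filter_from_filter FF.
have cvP x : A x ->
    \forall x' \near x & V \near powerset_filter_from F, (~` V)° x'.
  move=> Ax; have [V FV nV] := AF _ Ax.
  exists ((~` V)°, [set W | F W /\ W `<=` V]) => /=.
    by split; [exact: nbhs_interior|exact: powerset_filter_fromP].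
  move=> [y W] /= [Vy [_ WV]]; apply: filterS Vy => z; exact: subsetC.
have [R [RF Rm [V RV]] RA] := Ac _ _ _ PF cvP.
by exists V; [exact: RF|exact: RA].
Qed.

Lemma compact_compact_separation A B : hausdorff_space T ->
  compact A -> compact B -> A `&` B = set0 ->
  exists U V, [/\ open U, open V, A `<=` U, B `<=` V & U `&` V = set0].
Proof.
move=> hT cA cB AB0.
have [U sU BU] : exists2 U, set_nbhs A U & B `<=` (~` U)°.
  apply: compact_filter_separation => // y By.
  have [V Vy AV] : exists2 V, nbhs y V & A `<=` (~` V)°.
    apply: compact_filter_separation => // x Ax.
    have xy : x != y.
      by apply/negP => /eqP xy; rewrite -[False]/(set0 x) -AB0; split=> //; rewrite xy.
    move: hT; rewrite open_hausdorff => /(_ x y xy)[[U V]/=].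
    rewrite !inE => -[Ux Vy] [oU oV UV0].
    exists V; first exact: open_nbhs_nbhs.
    apply: (@filterS _ _ _ U); last exact: open_nbhs_nbhs.
    by apply/disjoints_subset.
  exists (~` V)°.
    apply/set_nbhsP; exists (~` V)°; split => //.
    exact: open_interior.
  by apply: filterS Vy => z Vz /interior_subset.
have [U' [oU' AU' U'U]] := (set_nbhsP _ _).1 sU.
exists U', (~` U)°; split=> //; first exact: open_interior.
by apply/disjoints_subset => x /U'U Ux /interior_subset.
Qed.

Lemma compact_setD A U : compact A -> open U -> compact (A `\` U).
Proof.
move=> cA oU; rewrite setDE; apply: compact_closedI => //.
exact: open_closedC.
Qed.

(** Needed for subadditivity of the content on open sets. [C \ V] and [C \ U] are disjoint and
    compact; removing disjoint open neighbourhoods of them from C leaves two compact pieces that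
    still cover C. *)
Lemma compact_setU_split C U V : hausdorff_space T -> compact C ->
  open U -> open V -> C `<=` U `|` V ->
  exists C1 C2, [/\ compact C1, compact C2, C1 `<=` U, C2 `<=` V &
    C = C1 `|` C2].
Proof.
move=> hT cC oU oV CUV.
have [||| U' [V' [oU' oV' CU' CV' UV0]]] :=
  @compact_compact_separation (C `\` V) (C `\` U) hT.
- exact: compact_setD.
- exact: compact_setD.
- apply/seteqP; split=> // x [[Cx nV] [_ nU]].
  by have [] := CUV _ Cx.
exists (C `\` V'), (C `\` U'); split.
- exact: compact_setD.
- exact: compact_setD.
- by move=> x [Cx nV']; apply: contrapT => nU; apply: nV'; exact: CV'.
- by move=> x [Cx nU']; apply: contrapT => nV; apply: nU'; exact: CU'.
apply/seteqP; split=> [x Cx|x [[]|[]]//].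
have [V'x|] := pselect (V' x); last by left.
right; split=> // U'x; have : (U' `&` V') x by [].
by rewrite UV0.
Qed.

End CompactSeparation.

(** * The outer measure of a finitely additive set function *)

Section Content.
Context {R : realType} {T : topologicalType}.
Variable m : set T -> R.
Hypotheses (hT : hausdorff_space T) (m_ge0 : forall B, 0 <= m B)
  (mU : forall A B, A `&` B = set0 -> m (A `|` B) = m A + m B).
Local Open Scope ereal_scope.

Let m0 : m set0 = 0%R.
Proof.
have := @mU set0 set0; rewrite setI0 setU0 => /(_ erefl).
by move/eqP; rewrite -[X in X == _]addr0 => /eqP/addrI.
Qed.

Let le_m A B : A `<=` B -> (m A <= m B)%R.
Proof.
move=> AB; rewrite -(setDUK AB) mU ?lerDl//.
by rewrite setDE setICA setICr setI0.
Qed.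

Let mU_le A B : (m (A `|` B) <= m A + m B)%R.
Proof.
have -> : A `|` B = A `|` (B `\` A) by rewrite setDE setUIr setUv setIT.
rewrite mU ?lerD ?le_m//.
by rewrite setDE setICA setICr setI0.
Qed.

(** The classical passage from a content to a regular outer measure: a supremum over compact subsets
    of open sets, then an infimum over open supersets. Compactness supplies the countable
    subadditivity that m lacks. *)
Definition inner_content (U : set T) :=
  ereal_sup [set (m C)%:E | C in [set C | compact C /\ C `<=` U]].

Definition content_outer (B : set T) :=
  ereal_inf [set inner_content U | U in [set U | open U /\ B `<=` U]].

Let inner_ge C U : compact C -> C `<=` U -> (m C)%:E <= inner_content U.
Proof. by move=> cC CU; apply: ereal_sup_ubound; exists C. Qed.

Let inner_ge0 U : 0 <= inner_content U.
Proof.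
apply: le_trans (@inner_ge set0 U _ _) => //; last exact: compact0.
by rewrite m0.
Qed.

Let le_inner U V : U `<=` V -> inner_content U <= inner_content V.
Proof.
move=> UV; apply: ge_ereal_sup => _ [C [cC CU] <-].
by apply: inner_ge => //; exact: subset_trans UV.
Qed.

Let outer_le B U : open U -> B `<=` U -> content_outer B <= inner_content U.
Proof. by move=> oU BU; apply: ereal_inf_lbound; exists U. Qed.

Let outer_open U : open U -> content_outer U = inner_content U.
Proof.
move=> oU; apply/eqP; rewrite eq_le outer_le//=.
by apply: le_ereal_inf_tmp => _ [V [oV UV] <-]; exact: le_inner.
Qed.

Let outer_ge0 B : 0 <= content_outer B.
Proof. by apply: le_ereal_inf_tmp => _ [V [oV UV] <-]; exact: inner_ge0. Qed.

Let outer0 : content_outer set0 = 0.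
Proof.
rewrite outer_open; last exact: open0.
apply/eqP; rewrite eq_le inner_ge0 andbT; apply: ge_ereal_sup => _ [C [_ C0] <-].
by move: C0; rewrite subset0 => ->; rewrite m0.
Qed.

Let le_outer : {homo content_outer : A B / A `<=` B >-> A <= B}.
Proof.
move=> A B AB; apply: le_ereal_inf_tmp => _ [V [oV BV] <-].
by apply: outer_le => //; exact: subset_trans BV.
Qed.

(** Finitely many [U n] cover C, and [compact_setU_split] cuts C into compact pieces contained in
    one [U i] each. *)
Let compact_bigcup_le (U : nat -> set T) C : (forall n, open (U n)) ->
  compact C -> C `<=` \bigcup_n U n ->
  (m C)%:E <= \sum_(n <oo) inner_content (U n).
Proof.
move=> oU cC CU.
have [N CN] : exists N, C `<=` \big[setU/set0]_(i < N) U i.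
  have /compact_near_coveringP/(_ nat \oo (fun n x =>
    (\big[setU/set0]_(i < n) U i) x)) := cC.
  case=> [x Cx|N _ /(_ N (leqnn N)) CN]; last by exists N.
  have [n _ Unx] := CU _ Cx.
  exists (U n, [set N | (n < N)%N]) => /=.
    by split; [exact: open_nbhs_nbhs|exists n.+1].
  move=> [z N] /= [Unz nN]; rewrite -bigcup_mkord; by exists n.
apply: le_trans (_ : \sum_(0 <= i < N) inner_content (U i) <= _); last first.
  exact: nneseries_lim_ge.
elim: N C cC CN {CU} => [|N ih] C cC CN.
  by move: CN; rewrite big_ord0 subset0 => ->; rewrite m0 big_geq.
move: CN; rewrite big_ord_recr big_nat_recr//= => CN.
have oUN : open (\big[setU/set0]_(i < N) U i).
  by rewrite -bigcup_mkord; apply: bigcup_open => i _.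
have [C1 [C2 [cC1 cC2 C1U C2U ->]]] :=
  compact_setU_split hT cC oUN (oU N) CN.
apply: le_trans (_ : (m C1 + m C2)%:E <= _); first by rewrite lee_fin.
by rewrite EFinD leeD ?ih//; exact: inner_ge.
Qed.

Let outer_sigma_subadditive : sigma_subadditive content_outer.
Proof.
move=> F; have [->|] := eqVneq (\sum_(i <oo) content_outer (F i)) +oo.
  by rewrite leey.
rewrite -ltey => Foo; apply/lee_addgt0Pr => e e0.
apply: le_trans (epsilon_trick _ _ (ltW e0)) => //.
have finF n : content_outer (F n) \is a fin_num.
  rewrite ge0_fin_numE//; apply: le_lt_trans Foo.
  apply: le_trans (nneseries_lim_ge n.+1 _) => //.
  by rewrite big_nat_recr//= leeDr// sume_ge0.
have UF n : exists U, [/\ open U, F n `<=` U &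
    inner_content U <= content_outer (F n) + (e / (2 ^ n.+1)%:R)%:E].
  have en : (0 < e / (2 ^ n.+1)%:R)%R by rewrite divr_gt0// ltr0n expn_gt0.
  have [_ [U [oU FU] <-] h] := lb_ereal_inf_adherent en (finF n).
  by exists U; split=> //; exact: ltW.
have [U UP] := choice UF.
apply: le_trans (_ : inner_content (\bigcup_n U n) <= _).
  apply: outer_le; first by apply: bigcup_open => n _; have [] := UP n.
  by apply: subset_bigcup => n _; have [] := UP n.
apply: ge_ereal_sup => _ [C [cC CU] <-].
apply: le_trans (compact_bigcup_le _ cC CU) _; first by move=> n; have [] := UP n.
by apply: lee_nneseries => [n _ _|n _]; [exact: inner_ge0|have [] := UP n].
Qed.

HB.instance Definition _ := isOuterMeasure.Build R T content_outer
  outer0 outer_ge0 le_outer outer_sigma_subadditive.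

(** For open V, take a compact C in [V & U] and then a compact D in the open set [V \ C], which
    contains [V \ U]. The disjoint union of C and D is compact in V, so m C + m D is at most the
    content of V; take suprema over D, then over C. *)
Lemma open_caratheodory U : open U -> content_outer.-caratheodory U.
Proof.
move=> oU; apply: le_caratheodory_measurable => X.
apply: le_ereal_inf_tmp => _ [V [oV XV] <-].
apply: le_trans (_ : inner_content (V `&` U) + content_outer (V `\` U) <= _).
  apply: leeD.
    by apply: outer_le; [exact: openI|exact: setSI].
  by rewrite -setDE; apply: le_outer; exact: setSD.
have [|] := eqVneq (inner_content V) +oo; first by move->; rewrite leey.
rewrite -ltey => Voo.
have finV : inner_content (V `\` U) \is a fin_num.
  rewrite ge0_fin_numE//; apply: le_lt_trans Voo; apply: le_inner.
  exact: subDsetl.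
have finVU : content_outer (V `\` U) \is a fin_num.
  rewrite ge0_fin_numE//; apply: le_lt_trans Voo; rewrite -outer_open//.
  apply: le_outer; exact: subDsetl.
rewrite -leeBrDr//; apply: ge_ereal_sup => _ [C [cC CVU] <-].
rewrite leeBrDr// addeC -leeBrDr//.
have oVC : open (V `\` C).
  by rewrite setDE; apply: openI => //; exact: closed_openC (compact_closed hT cC).
apply: le_trans (_ : inner_content (V `\` C) <= _).
  apply: outer_le => // x [Vx nUx]; split=> // /CVU[_]; exact: nUx.
apply: ge_ereal_sup => _ [D [cD DVC] <-].
rewrite leeBrDr// -EFinD -mU; last first.
  by apply/seteqP; split=> // x [/DVC[]].
apply: inner_ge; first exact: compactU.
by move=> x [/DVC[]//|/CVU[]].
Qed.

Lemma content_outer_compact C : compact C -> (m C)%:E <= content_outer C.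
Proof.
by move=> cC; apply: le_ereal_inf_tmp => _ [V [oV CV] <-]; exact: inner_ge.
Qed.

(** A closed F is replaced by the compact [F & C] at a loss of at most e, by tightness. As in the
    portmanteau theorem, closed sets can only gain mass. *)
Lemma content_outer_tight : m setT = 1%R ->
  (forall e : R, (0 < e)%R -> exists2 C, compact C & (1 - e <= m C)%R) ->
  content_outer setT = 1 /\
  forall F, closed F -> (m F)%:E <= content_outer F.
Proof.
move=> m1 tight.
have leT : content_outer setT <= 1.
  rewrite outer_open; last exact: openT.
  apply: ge_ereal_sup => _ [C _ <-]; rewrite lee_fin -m1; exact: le_m.
have closedF F : closed F -> (m F)%:E <= content_outer F.
  move=> cF; apply/lee_addgt0Pr => e e0; have [C cC mC] := tight e e0.
  have cFC : compact (F `&` C) by rewrite setIC; exact: compact_closedI.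
  apply: le_trans (_ : (m (F `&` C))%:E + e%:E <= _).
    rewrite -EFinD lee_fin -[in leLHS](setUIDK F C).
    rewrite (le_trans (mU_le _ _))// lerD2l.
    have : (m (C `|` ~` C) = m C + m (~` C))%R by rewrite mU// setICr.
    rewrite setUv m1; have : (m (F `\` C) <= m (~` C))%R by apply: le_m => x [].
    lra.
  rewrite leeD2r//; apply: le_trans (content_outer_compact cFC) _.
  by apply: le_outer; exact: subIsetl.
split=> //; apply/eqP; rewrite eq_le leT/= -m1.
by apply: closedF; exact: closedT.
Qed.

Lemma open_generated_caratheodory B : <<s @open T >> B ->
  content_outer.-caratheodory B.
Proof.
apply: smallest_sub; last exact: open_caratheodory.
split; first exact: caratheodory_measurable_set0.
- by move=> A mA; rewrite setTD; exact: caratheodory_measurable_setC.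
- by move=> F mF; exact: caratheodory_measurable_bigcup.
Qed.

(** Exports the outer measure structure, whose proof depends on the section hypotheses. *)
Lemma content_outer_measure : exists mu : {outer_measure set T -> \bar R},
  mu = content_outer :> (set T -> \bar R).
Proof. by exists content_outer. Qed.

End Content.

Section OuterProbability.
Context {R : realType} d {T : measurableType d}.
Variable mu : {outer_measure set T -> \bar R}.
Hypotheses (mu_car : forall B, measurable B -> mu.-caratheodory B)
  (mu1 : mu setT = 1%E).

Let P B := mu B.

Let P0 : P set0 = 0%E. Proof. exact: outer_measure0. Qed.

Let P_ge0 B : (0 <= P B)%E. Proof. exact: outer_measure_ge0. Qed.

Let P_sigma : semi_sigma_additive P.
Proof.
move=> A mA tA mUA.
apply: (@caratheodory_measure_sigma_additive _ _ mu A) => //.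
- by move=> i; exact: mu_car.
- exact: mu_car.
Qed.

HB.instance Definition _ := isMeasure.Build d T R P P0 P_ge0 P_sigma.

Let P1 : P setT = 1%E. Proof. exact: mu1. Qed.

HB.instance Definition _ := Measure_isProbability.Build d T R P P1.

Lemma outer_measure_probability : exists Q : probability T R,
  forall B, Q B = mu B.
Proof. by exists P. Qed.

End OuterProbability.

(** * Integrals of bounded functions and the moment problem *)

Section Bounded.
Context {R : realType} d {T : measurableType d}.
Implicit Types (K : set T) (f : T -> R).

Lemma bounded_on_integrable (mu : {finite_measure set T -> \bar R}) K f :
  measurable K -> measurable_fun K f -> bounded_on K f ->
  mu.-integrable K (EFin \o f).
Proof.
move=> mK mf [C fC]; apply: measurable_bounded_integrable => //.
  by rewrite -ge0_fin_numE// fin_num_measure.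
exists C; split; first exact: num_real.
by move=> M CM x Kx; exact: le_trans (fC _ Kx) (ltW CM).
Qed.

End Bounded.

Section LayerCake.
Context {R : realType}.

(** For y <= n the sum is the integer part of y, hence within 1 of y; the minima with n make the
    induction work. *)
Lemma level_count (n : nat) (y : R) : 0 <= y ->
  Num.min (y - 1) n%:R <= \sum_(k < n) (k.+1%:R <= y)%R%:R <= Num.min y n%:R.
Proof.
move=> y0; elim: n => [|n ih]; first by rewrite big_ord0 ge_min le_min y0 lexx orbT.
rewrite big_ord_recr/=; move: ih; set s := \sum_(_ < _) _.
have [|h] := leP n.+1%:R y; rewrite /= ?mulr1n ?mulr0n ?addr0.
  rewrite -natr1 => h /andP[h1 h2]; move: h1 h2.
  by rewrite !minEle; repeat case: ifPn; rewrite -?ltNge; move=> *; apply/andP; split; lra.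
move: h; rewrite -natr1 => h /andP[h1 h2]; move: h1 h2.
by rewrite !minEle; repeat case: ifPn; rewrite -?ltNge; move=> *; apply/andP; split; lra.
Qed.

Context d {T : measurableType d}.
Implicit Types (K : set T) (f : T -> R) (l : (T -> R) -> R).

(* Layer cake: f is approximated by step functions built on its superlevel
   sets. *)
Lemma positive_functional_le_Rintegral (P : probability T R) K l f :
  positive_functional K l -> measurable K -> P K = 1%E ->
  measurable_fun K f -> bounded_on K f ->
  (forall c, l (\1_(K `&` [set x | c <= f x])) <=
     fine (P (K `&` [set x | c <= f x]))) ->
  l f <= \int[P]_(x in K) f x.
Proof.
move=> pl mK PK mf bf level.
have [C fC] := bf.
(* The shift by N brings the values of f on K into [0, 2N]; adding 1 keeps N positive. *)
pose N := `|C| + 1; have N0 : 0 < N by rewrite ltr_wpDl.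
have fN x : K x -> 0 <= f x + N <= N *+ 2.
  move=> Kx; have := le_trans (fC _ Kx) (ler_norm C); rewrite ler_norml => /andP[h1 h2].
  by rewrite /N mulr2n; apply/andP; split; lra.
(* Approximation by n levels costs at most 2N / n; then n tends to infinity. *)
suff h (n : nat) : (n%:R : R) * (l f - \int[P]_(x in K) f x) <= N *+ 2.
  rewrite leNgt; apply/negP; rewrite -subr_gt0 => d0.
  have := h (Num.bound (N *+ 2 / (l f - \int[P]_(x in K) f x))).
  rewrite leNgt => /negP; apply; rewrite -ltr_pdivrMr//.
  by apply: archi_boundP; rewrite divr_ge0 ?mulrn_wge0// ltW.
case: n => [|n]; first by rewrite mul0r mulrn_wge0// ltW.
(* Rescales f + N to [0, n + 1], so that each level has height 1. *)
pose c : R := n.+1%:R / (N *+ 2).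
have c0 : 0 < c by rewrite divr_gt0// pmulrn_lgt0.
pose y x := c * (f x + N).
have by_ : bounded_on K y by apply: bounded_onZ; apply: bounded_onD => //; exact: bounded_on_cst.
have yn x : K x -> 0 <= y x <= n.+1%:R.
  move=> /fN/andP[h1 h2]; rewrite mulr_ge0//=; last exact: ltW.
  by rewrite /y /c mulrAC ler_pdivrMr ?pmulrn_lgt0// ler_pM2l.
pose F (k : nat) := K `&` [set x | k.+1%:R / c - N <= f x].
have FE x k : K x -> \1_(F k) x = (k.+1%:R <= y x)%R%:R :> R.
  move=> Kx; rewrite indicE; congr (_ : bool)%:R.
  apply/idP/idP => [/set_mem[_ /=]|h].
    by rewrite lerBlDr ler_pdivrMr// mulrC.
  by apply/mem_set; split=> //=; rewrite lerBlDr ler_pdivrMr// mulrC.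
pose s m x : R := \sum_(k < m) \1_(F k) x.
have mF k : measurable (F k).
  rewrite (_ : F k = K `&` f @^-1` `[k.+1%:R / c - N, +oo[).
    exact: mf.
  by apply/seteqP; split=> x [Kx] /=; rewrite in_itv/= andbT.
have sP m : [/\ bounded_on K (s m), measurable_fun K (s m) &
    l (s m) <= \int[P]_(x in K) s m x].
  elim: m => [|m [bs ms ls]].
    have -> : s 0%N = cst 0 by apply/funext => x; rewrite /s big_ord0.
    split; [exact: (bounded_on_cst K 0)|exact: measurable_cst|].
    by rewrite (pf_cst 0 pl) Rintegral_cst// mul0r.
  have sE : s m.+1 = fun x => s m x + \1_(F m) x.
    by apply/funext => x; rewrite /s big_ord_recr.
  have mi : measurable_fun K (\1_(F m) : T -> R) by exact: measurable_indic.
  have bi := bounded_on_indic K (F m).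
  rewrite sE; split; [exact: bounded_onD|exact: measurable_funD|].
  rewrite (pfD pl)// RintegralD//; [|exact: bounded_on_integrable..].
  rewrite lerD// /Rintegral integral_indic// (_ : F m `&` K = F m); first exact: level.
  by apply/setIidPl; exact: subIsetl.
have [bs ms ls] := sP n.+1.
have sE x : K x -> s n.+1 x = \sum_(k < n.+1) (k.+1%:R <= y x)%R%:R.
  by move=> Kx; apply: eq_bigr => k _; exact: FE.
have my : measurable_fun K y.
  by apply: measurable_funM => //; apply: measurable_funD.
have ly : l y <= 1 + l (s n.+1).
  rewrite -[X in X + _](pf_cst 1 pl) -(pfD pl)//; last exact: bounded_on_cst.
  apply: pf_le pl _ _ _ => //; first by apply: bounded_onD => //; exact: bounded_on_cst.
  move=> x Kx; rewrite sE//; have /andP[y0 yn1] := yn _ Kx.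
  have /andP[+ _] := level_count n.+1 y0.
  by rewrite min_l; lra.
have sy : \int[P]_(x in K) s n.+1 x <= \int[P]_(x in K) y x.
  apply: le_Rintegral => //; [exact: bounded_on_integrable..|].
  move=> x Kx; rewrite sE//; have /andP[y0 yn1] := yn _ Kx.
  have /andP[_] := level_count n.+1 y0.
  by rewrite min_l.
have lyE : l y = c * (l f + N).
  rewrite (pfZ pl); last by apply: bounded_onD => //; exact: bounded_on_cst.
  by rewrite (pfD pl)//; [rewrite (pf_cst _ pl)|exact: bounded_on_cst].
have iyE : \int[P]_(x in K) y x = c * (\int[P]_(x in K) f x + N).
  rewrite RintegralZl//; last first.
    apply: bounded_on_integrable => //; first exact: measurable_funD.
    by apply: bounded_onD => //; exact: bounded_on_cst.
  rewrite RintegralD//; [|exact: bounded_on_integrable|exact: finite_measure_integrable_cst].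
  by rewrite Rintegral_cst// [X in N * X](congr1 fine PK) mulr1.
have : c * (l f - \int[P]_(x in K) f x) <= 1.
  by rewrite mulrBr; move: ly ls sy; rewrite lyE iyE; lra.
by rewrite /c mulrAC ler_pdivrMr ?pmulrn_lgt0// mul1r.
Qed.

End LayerCake.

Section Moment.
Context {R : realType} {T : topologicalType}.

(* The moment problem with constraints "the integral of g is nonnegative". *)
Lemma cone_outer_measure (K : set T) (G : set (T -> R)) :
  hausdorff_space T -> convex_cone G ->
  (forall g (e : R), G g -> 0 < e -> ~ (forall x, K x -> g x <= - e)) ->
  (forall e : R, 0 < e -> exists C g, [/\ compact C, G g &
     forall x, K x -> g x <= e - 1 + \1_C x]) ->
  exists (l : (T -> R) -> R) (mu : {outer_measure set T -> \bar R}),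
  [/\ positive_functional K l,
    (forall f g, bounded_on K f -> G g -> (forall x, K x -> g x <= f x) -> 0 <= l f),
    (forall B, <<s @open T >> B -> mu.-caratheodory B),
    mu setT = 1%E &
    forall F, closed F -> ((l \1_F)%:E <= mu F)%E].
Proof.
move=> hT GG Gneg tight.
have [l pl lG] := cone_positive_functional GG Gneg.
pose m (B : set T) : R := l \1_B.
have bi (B : set T) := bounded_on_indic K B : bounded_on K (\1_B : T -> R).
have m_ge0 B : 0 <= m B.
  by apply: (pf_ge0 pl) => // x _; rewrite indicE.
have mU A B : A `&` B = set0 -> m (A `|` B) = m A + m B.
  move=> AB0; rewrite /m -(pfD pl)//; congr l; apply/funext => x.
  rewrite !indicE in_setU; have : x \notin A `&` B by rewrite AB0 in_set0.
  by rewrite in_setI; case: (x \in A); case: (x \in B) => //=; rewrite ?addr0 ?add0r.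
have m1 : m setT = 1 by rewrite /m indicT; exact: pf1 pl.
(* Tightness of m: applying l to the bound e - 1 + 1_C above a cone element gives 0 <= e - 1 + m
   C. *)
have tm e : 0 < e -> exists2 C, compact C & 1 - e <= m C.
  move=> e0; have [C [g [cC Gg gC]]] := tight e e0; exists C => //.
  have bC := bounded_onD (bounded_on_cst K (e - 1)) (bi C).
  have := lG _ _ bC Gg gC; rewrite (pfD pl)//; last exact: bounded_on_cst.
  by rewrite (pf_cst _ pl) -/(m C); lra.
have [mu muE] := content_outer_measure hT m_ge0 mU.
have [mu1 muF] := content_outer_tight m_ge0 mU m1 tm.
exists l, mu; split=> //; rewrite ?muE//.
exact: open_generated_caratheodory.
Qed.

End Moment.

(** * Borel spaces *)

Section BorelSpaces.
Context {R : realType} {d : measure_display} (S : borelSpaceType R d).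

Lemma borelSpace_hausdorff : hausdorff_space S.
Proof.
have [X [f [hX _ finj fop _]]] := @borel_embedding _ _ S.
rewrite open_hausdorff => x y xy.
have fxy : f x != f y by apply: contra_neq xy => /finj.
move: hX; rewrite open_hausdorff => /(_ _ _ fxy)[[U V]/=].
rewrite !inE => -[Ux Vy] [oU oV UV0].
exists (f @^-1` U, f @^-1` V); first by rewrite !inE.
split; [by apply/fop; exists U|by apply/fop; exists V|].
by rewrite -preimage_setI UV0 preimage_set0.
Qed.

Lemma borelSpace_measurable_open (U : set S) : open U -> measurable U.
Proof. by move=> oU; rewrite borel_measurable; exact: sub_sigma_algebra. Qed.

(** Balls of radius 1/(n+1) around a countable dense set of X, pulled back along the embedding. The
    union over the points of code [i.1] has at most one member; it avoids inverting the numbering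
    g. *)
Lemma borelSpace_countable_base : exists B : nat * nat -> set S,
  (forall i, open (B i)) /\
  forall (U : set S) s, open U -> U s -> exists i, B i s /\ B i `<=` U.
Proof.
have [X [f [hX [D [cD dD]] finj fop _]]] := @borel_embedding _ _ S.
have /countable_injP[g ginj] := cD.
exists (fun i => f @^-1` (\bigcup_(x in [set x | D x /\ g x = i.1])
                            (ball x (i.2.+1%:R^-1 : R))°)).
split.
  move=> i; apply/fop; eexists; last reflexivity.
  by apply: bigcup_open => x _; exact: open_interior.
move=> U s /fop[V oV ->] /= Vfs.
have : nbhs (f s) V by exact: open_nbhs_nbhs.
move=> /nbhs_ballP[r /= r0 rV].
(* With 2e <= r, a ball of radius e around a dense point near [f s] stays inside the r-ball around
   [f s]. *)
pose n := Num.bound (2 / r); pose e : R := n.+1%:R^-1.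
have e0 : 0 < e by rewrite invr_gt0.
have er : e + e <= r.
  rewrite -mulr2n -mulr_natl /e ler_pdivrMr// -ler_pdivrMl//.
  rewrite mulrC (le_trans (ltW (archi_boundP _)))//.
    by rewrite divr_ge0// ltW.
  by rewrite ler_nat.
have [x [/interior_subset xfs Dx]] : (ball (f s) (e / 2))° `&` D !=set0.
  apply: dD; last exact: open_interior.
  by exists (f s); apply: nbhsx_ballx; rewrite divr_gt0.
exists (g x, n); split=> [/=|t [/= y [Dy gyx]] /interior_subset yt].
  exists x => //; apply/nbhs_ballP; exists (e / 2); first by rewrite /= divr_gt0.
  by move=> y; apply: ball_split; exact: ball_sym.
have yx : y = x by apply: ginj => //; exact/mem_set.
apply: rV; apply: (le_ball er); move: yt; rewrite yx; apply: ball_triangle.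
by apply: le_ball xfs; lra.
Qed.

(** A point outside F has a ball around its image that lies in V, so it belongs to [C n] for all
    large n. Functions that are 0 on [C n] and 1 outside V, pulled back along f, are thus eventually
    equal to the indicator of F. *)
Lemma borelSpace_closed_approx (F : set S) : closed F ->
  exists phi : nat -> S -> R, [/\ forall n, continuous (phi n),
    forall n s, 0 <= phi n s <= 1 &
    forall s, \forall n \near \oo, phi n s = \1_F s].
Proof.
have [X [f [_ _ _ fop _]]] := @borel_embedding _ _ S.
have fc : continuous f by apply/continuousP => V oV; apply/fop; exists V.
move=> /closed_openC /fop[V oV FV].
have FE s : F s <-> ~ V (f s).
  by rewrite -[V (f s)]/((f @^-1` V) s) -FV/= notK.
pose C n := [set x : X | forall y, ball x (n.+1%:R^-1 : R) y -> V y].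
have phiP n : exists phi : X -> R, [/\ continuous phi, range phi `<=` `[0, 1],
    phi @` C n `<=` [set 0] & phi @` (~` V) `<=` [set 1]].
  apply/uniform_separatorP; apply: uniform_separatorW.
  have e0 : 0 < (n.+1%:R^-1 : R) by rewrite invr_gt0.
  (* Points of [C n] and of the complement of V are never 1/(n+1)-close, so this entourage separates
     them uniformly. *)
  exists [set xy : X * X | ball xy.1 (n.+1%:R^-1 : R) xy.2].
    exact: (entourage_ball _ (PosNum e0)).
  by apply/seteqP; split=> // -[x y] [[/= Cx Vy] xy]; exact/Vy/Cx.
have [phi phiE] := choice phiP.
exists (fun n => phi n \o f); split.
- by move=> n s; apply: continuous_comp; [exact: fc|have [+ _ _ _] := phiE n; apply].
- move=> n s; have [_ h _ _] := phiE n.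
  by have /h/= := imageT (phi n) (f s); rewrite in_itv.
- move=> s; have [Fs|nFs] := pselect (F s).
    apply: nearW => n /=; have [_ _ _ h] := phiE n.
    rewrite indicE mem_set//=; apply: h; exists (f s) => //.
    exact/FE.
  have /nbhs_ballP[r /= r0 rV] : nbhs (f s) V.
    by apply: open_nbhs_nbhs; split=> //; apply: contrapT => h; exact/nFs/FE.
  exists (Num.bound r^-1) => // n /= rn; have [_ _ h _] := phiE n.
  rewrite indicE memNset//=; apply: h; exists (f s) => // y ny.
  apply: rV; apply: le_ball ny; rewrite invf_ple ?posrE//.
  apply: le_trans (ltW (archi_boundP _)) _; first by rewrite invr_ge0 ltW.
  by rewrite ler_nat (leq_trans rn).
Qed.

Lemma borelSpace_continuous_measurable (h : S -> R) :
  continuous h -> measurable_fun setT h.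
Proof.
move=> ch; apply: (measurability _ (RGenOpens.measurableE R)).
move=> _ [_ [x [y ->] <-]]; rewrite setTI; apply: borelSpace_measurable_open.
apply: open_comp; [by move=> s _; exact: ch|exact: interval_open].
Qed.

End BorelSpaces.

Section Product.
Context {R : realType} {dS dA} (S : borelSpaceType R dS)
  (A : borelSpaceType R dA).

Lemma borelSpace_prod_hausdorff : hausdorff_space (S * A)%type.
Proof.
rewrite open_hausdorff => -[s a] [t b] /=; rewrite xpair_eqE negb_and => /orP[st|ab].
  have := @borelSpace_hausdorff _ _ S; rewrite open_hausdorff => /(_ _ _ st)[[U V]/=].
  rewrite !inE => -[Us Vt] [oU oV UV0].
  exists (fst @^-1` U, fst @^-1` V); first by rewrite !inE.
  split; [by apply: open_comp => // x _; exact: cvg_fst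
    |by apply: open_comp => // x _; exact: cvg_fst|].
  by rewrite -preimage_setI UV0 preimage_set0.
have := @borelSpace_hausdorff _ _ A; rewrite open_hausdorff => /(_ _ _ ab)[[U V]/=].
rewrite !inE => -[Us Vt] [oU oV UV0].
exists (snd @^-1` U, snd @^-1` V); first by rewrite !inE.
split; [by apply: open_comp => // x _; exact: cvg_snd
  |by apply: open_comp => // x _; exact: cvg_snd|].
by rewrite -preimage_setI UV0 preimage_set0.
Qed.

(** Here second countability matters: an open set is the union of the basic rectangles that it
    contains, and these are countably many. *)
Lemma borelSpace_prod_measurable_open (U : set (S * A)) : open U -> measurable U.
Proof.
move=> oU.
have [B [oB BP]] := borelSpace_countable_base S.
have [C [oC CP]] := borelSpace_countable_base A.
have -> : U = \bigcup_(i : (nat * nat) * (nat * nat))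
    (if `[< B i.1 `*` C i.2 `<=` U >] then B i.1 `*` C i.2 else set0).
  apply/seteqP; split=> [[s a] Usa|[s a] [i _]]; last first.
    by case: asboolP => // h; exact: h.
  have : nbhs (s, a) U by exact: open_nbhs_nbhs.
  move=> [[P Q] /= [Ps Qa] PQU].
  move: Ps Qa; rewrite !nbhsE => -[P' [oP' P's] P'P] [Q' [oQ' Q'a] Q'Q].
  have [i [Bs BP']] := BP _ _ oP' P's.
  have [j [Ca CQ']] := CP _ _ oQ' Q'a.
  exists (i, j) => //=; case: asboolP => // -[] [t b] [/= Bt Cb].
  by apply: PQU; split=> /=; [exact/P'P/BP'|exact/Q'Q/CQ'].
apply: countable_bigcupT_measurable; first exact: countableP.
move=> i; case: asboolP => // _.
by apply: measurableX; exact: borelSpace_measurable_open.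
Qed.

(** The outer measure is known to be additive on sets generated by open ones, whereas a probability
    on S * A lives on the product sigma-algebra. *)
Lemma borelSpace_prod_measurableE (B : set (S * A)) :
  measurable B -> <<s @open (S * A)%type >> B.
Proof.
rewrite measurable_prod_measurableType.
apply: smallest_sub; first exact: smallest_sigma_algebra.
move=> _ [U mU] [V mV <-].
have pre (T : topologicalType) (f : S * A -> T) (W : set T) : continuous f ->
    <<s @open T >> W -> <<s @open (S * A)%type >> (f @^-1` W).
  move=> cf; move: W; apply: smallest_sub.
    have [s0 sC sU] := smallest_sigma_algebra setT (@open (S * A)%type).
    split.
    - by rewrite /= preimage_set0.
    - by move=> X /= /sC; rewrite !setTD preimage_setC.
    - by move=> F /= FX; rewrite preimage_bigcup; exact: sU.
  move=> W oW; apply: sub_sigma_algebra.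
  by apply: open_comp => // x _; exact: cf.
apply: (@measurableI _ (g_sigma_algebraType (@open (S * A)%type))).
- by apply: pre; [move=> x; exact: cvg_fst|rewrite -borel_measurable].
- by apply: pre; [move=> x; exact: cvg_snd|rewrite -borel_measurable].
Qed.

End Product.

(** * Signed measures and kernels *)

Section NonnegativeCharges.
Context {R : realType} d {T : measurableType d}.
Implicit Types (nu : {charge set T -> \bar R}) (m : {finite_measure set T -> \bar R}).

Lemma eq_measure_Rintegral m m' (D : set T) (f : T -> R) :
  (forall B, measurable B -> m B = m' B) ->
  \int[m]_(x in D) f x = \int[m']_(x in D) f x.
Proof.
move=> mm'; rewrite /Rintegral; congr fine.
by apply: eq_measure_integral => B mB _; exact: mm'.
Qed.

(** Whichever Hahn decomposition was chosen, the negative part of a nonnegative charge is null, so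
    [cintegral] and the total variation reduce to integrals against one finite measure. *)
Lemma charge_ge0_measure nu : charge_ge0 nu ->
  exists m, [/\ forall B, measurable B -> m B = nu B,
    forall (D : set T) (f : T -> R), cintegral nu D f = \int[m]_(x in D) f x &
    forall (D : set T) (f : T -> \bar R),
      (\int[Defs.total_variation nu]_(x in D) f x = \int[m]_(x in D) f x)%E].
Proof.
move=> nu0; exists (jordan_pos (hahnP nu)).
have N0 B : measurable B -> jordan_neg (hahnP nu) B = 0%E.
  move=> mB; apply/eqP; rewrite eq_le measure_ge0 andbT.
  have [_ [mN negN] _ _] := hahnP nu.
  rewrite jordan_negE cjordan_negE /crestr0 mem_set// /crestr oppe_le0.
  by apply: nu0; exact: measurableI.
split.
- move=> B mB; rewrite [RHS](jordan_decomp (hahnP nu) mB).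
  change (jordan_pos (hahnP nu) B =
    jordan_pos (hahnP nu) B + (-1)%:E * jordan_neg (hahnP nu) B)%E.
  by rewrite N0// mule0 adde0.
- move=> D f; rewrite /cintegral [X in _ - X](_ : _ = 0) ?subr0//.
  rewrite /Rintegral -[RHS]/(fine 0%E); congr fine.
  rewrite -[RHS](integral_measure_zero D (EFin \o f)).
  by apply: eq_measure_integral => B mB _; exact: N0.
- move=> D f; apply: eq_measure_integral => B mB _.
  change (jordan_pos (hahnP nu) B + jordan_neg (hahnP nu) B =
    jordan_pos (hahnP nu) B)%E.
  by rewrite N0// adde0.
Qed.

Lemma charge_of_finite_measure_ge0 m : charge_ge0 (charge_of_finite_measure m).
Proof. by move=> B mB; exact: measure_ge0. Qed.

Lemma cintegral_charge_of_finite_measure m D f :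
  cintegral (charge_of_finite_measure m) D f = \int[m]_(x in D) f x.
Proof.
have [m' [m'E -> _]] := charge_ge0_measure (@charge_of_finite_measure_ge0 m).
exact: eq_measure_Rintegral.
Qed.

Lemma integral_total_variation_charge_of_finite_measure m D f :
  (\int[Defs.total_variation (charge_of_finite_measure m)]_(x in D) f x =
   \int[m]_(x in D) f x)%E.
Proof.
have [m' [m'E _ ->]] := charge_ge0_measure (@charge_of_finite_measure_ge0 m).
by apply: eq_measure_integral => B mB _; exact: m'E.
Qed.

End NonnegativeCharges.

Section TransitionKernel.
Context {R : realType} {dS dA} {S : borelSpaceType R dS}
  {A : borelSpaceType R dA} (M : mdp S A).
Local Notation K := (K M).
Local Notation Q := (Q M).

Lemma K_measurable : measurable K.
Proof.
rewrite -[K]setCK; apply: measurableC; apply: borelSpace_prod_measurable_open.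
exact/closed_openC/K_closed.
Qed.

(* Q is measurable on K only, hence is extended by 0; the unit makes it a kernel
   that composes with [constker]. *)
Definition Qker (x : unit * (S * A)) : {measure set S -> \bar R} :=
  if x.2 \in K then (Q x.2 : {measure set S -> \bar R}) else mzero.

Lemma Qker_in u x B : K x -> Qker (u, x) B = Q x B.
Proof. by move=> Kx; rewrite /Qker/= mem_set. Qed.

Lemma Qker_notin u x B : ~ K x -> Qker (u, x) B = 0%E.
Proof. by move=> nKx; rewrite /Qker/= memNset. Qed.

Let measurable_Qker B : measurable B -> measurable_fun setT (Qker ^~ B).
Proof.
move=> mB.
rewrite (_ : Qker ^~ B = ((fun x => Q x B) \_ K) \o snd); last first.
  by apply/funext => -[u x]; rewrite /Qker /= patchE; case: ifPn.
apply: measurableT_comp => //; apply/(measurable_restrictT _ K_measurable).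
exact: Q_measurable.
Qed.

HB.instance Definition _ :=
  isKernel.Build _ _ (unit * (S * A))%type S R Qker measurable_Qker.

Let Qker_uub : measure_fam_uub Qker.
Proof.
exists 2 => -[u x]; rewrite /Qker/=; case: ifPn => _.
  by rewrite [X in (X < _)%E](@probability_setT _ _ _ (Q x)) lte_fin ltr1n.
by rewrite /mzero lte_fin.
Qed.

HB.instance Definition _ :=
  Kernel_isFinite.Build _ _ (unit * (S * A))%type S R Qker Qker_uub.

Section Mixture.
Variable m : {finite_measure set (S * A)%type -> \bar R}.

(** The measure m as a kernel from a one-point space, so that [kcomp constker Qker] is the mixture
    of the laws [Q x] under m. *)
Definition constker (u : unit) : {measure set (S * A)%type -> \bar R} := m.

Let measurable_constker B : measurable B -> measurable_fun setT (constker ^~ B).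
Proof. by move=> mB; exact: measurable_cst. Qed.

HB.instance Definition _ :=
  isKernel.Build _ _ unit (S * A)%type R constker measurable_constker.

Let constker_uub : measure_fam_uub constker.
Proof.
exists (fine (m setT) + 1) => u; rewrite EFinD fineK ?fin_num_measure//.
by rewrite lteDl// fin_num_measure.
Qed.

HB.instance Definition _ :=
  Kernel_isFinite.Build _ _ unit (S * A)%type R constker constker_uub.

Lemma measurable_integral_Q (h : S -> \bar R) : (forall s, (0 <= h s)%E) ->
  measurable_fun setT h -> measurable_fun K (fun x => \int[Q x]_s h s)%E.
Proof.
move=> h0 mh.
apply: (@eq_measurable_fun _ _ _ _ _ (fun x => \int[Qker (tt, x)]_s h s)%E).
  by move=> x /set_mem Kx; apply: eq_measure_integral => B mB _; exact: Qker_in.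
apply: measurable_funTS.
apply: (@measurable_fun_integral_kernel _ _ _ _ R (fun x => Qker (tt, x))) => //.
by move=> B mB; apply: measurableT_comp (measurable_Qker mB) _.
Qed.

Hypothesis balance : forall B, measurable B ->
  (m (fst @^-1` B) = \int[m]_(x in K) Q x B)%E.

(** By [balance], the S-marginal of m and the mixture are the same measure; the two sides are the
    integral of h against it. *)
Lemma ge0_integral_balance (h : S -> \bar R) : (forall s, (0 <= h s)%E) ->
  measurable_fun setT h ->
  (\int[m]_x h x.1 = \int[m]_(x in K) \int[Q x]_s h s)%E.
Proof.
move=> h0 mh.
have mfst : measurable_fun setT (fst : S * A -> S) by exact: measurable_fst.
transitivity (\int[pushforward m fst]_s h s)%E.
  rewrite (ge0_integral_pushforward mfst)//.
transitivity (\int[kcomp constker Qker tt]_s h s)%E.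
  apply: eq_measure_integral => B mB _; rewrite /pushforward.
  rewrite [LHS](balance mB) /kcomp integral_mkcond; apply: eq_integral => x _.
  rewrite patchE; case: (boolP (x \in K)) => [/set_mem Kx|/negP nKx].
    by apply/esym; exact: Qker_in.
  by apply/esym; apply: Qker_notin => /mem_set.
rewrite [LHS](@integral_kcomp _ _ _ _ _ _ R constker Qker tt h)//.
rewrite [RHS]integral_mkcond; apply: eq_integral => x _.
rewrite patchE; case: (boolP (x \in K)) => [/set_mem Kx|/negP nKx].
  by apply: eq_measure_integral => B mB _; exact: Qker_in.
rewrite -[RHS](integral_measure_zero setT h).
by apply: eq_measure_integral => B mB _; apply: Qker_notin => /mem_set.
Qed.

End Mixture.
End TransitionKernel.

(** * Integrals of negative parts *)

Section Negpart.
Context {R : realType}.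
Implicit Types x y t : R.

Lemma negpart_le0 x : negpart x <= 0.
Proof. by rewrite /negpart ge_min lexx orbT. Qed.

Lemma le_negpart x y : x <= y -> negpart x <= negpart y.
Proof. by move=> xy; rewrite /negpart le_min !ge_min xy lexx orbT. Qed.

Lemma negpart_dist x y : `|negpart x - negpart y| <= `|x - y|.
Proof.
wlog xy : x y / x <= y.
  by move=> h; have [/h//|/ltW/h] := leP x y; rewrite distrC (distrC y).
rewrite ler0_norm ?subr_le0 ?le_negpart// ler0_norm ?subr_le0//.
by rewrite /negpart !minEle; case: ifPn; case: ifPn; rewrite -?ltNge => *; lra.
Qed.

Lemma ler_norm_negpart x : `|negpart x| <= `|x|.
Proof.
have := negpart_dist x 0; rewrite subr0 {2}/negpart minxx subr0.
by [].
Qed.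

Lemma measurable_negpart d (T : measurableType d) (D : set T) (f : T -> R) :
  measurable_fun D f -> measurable_fun D (fun z => negpart (f z)).
Proof.
by move=> mf; exact: (measurable_minr mf (@measurable_cst _ _ _ _ D (0 : R))).
Qed.

Lemma lipschitz_continuous (f : R -> R) (C : R) :
  (forall x y, `|f x - f y| <= C * `|x - y|) -> continuous f.
Proof.
move=> fC x; apply/cvgrPdist_lt => e e0.
have C0 : 0 < `|C| + 1 by rewrite ltr_wpDl.
near=> y; apply: le_lt_trans (fC _ _) _.
apply: le_lt_trans (_ : (`|C| + 1) * `|x - y| < _).
  by rewrite ler_wpM2r// (le_trans (ler_norm C))// lerDl.
rewrite -ltr_pdivlMl// mulrC; near: y.
apply/nbhs_ballP; exists (e / (`|C| + 1)) => //=; first by rewrite divr_gt0.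
Unshelve. all: by end_near. Qed.

Lemma continuous_negpartBr (t : R) : continuous (fun eta : R => negpart (t - eta)).
Proof.
apply: (@lipschitz_continuous _ 1) => s s'; rewrite mul1r.
apply: le_trans (negpart_dist _ _) _.
by rewrite (_ : t - s - (t - s') = - (s - s')) ?normrN//; ring.
Qed.

End Negpart.

Section NegpartIntegral.
Context {R : realType} d {X : measurableType d}.
Variables (m : {finite_measure set X -> \bar R}) (D : set X) (f : X -> R).
Hypotheses (mD : measurable D) (mf : measurable_fun D f) (bf : bounded_on D f).

Lemma bounded_on_negpart t : bounded_on D (fun x => negpart (f x - t)).
Proof.
have [C fC] := bounded_onD bf (bounded_on_cst D (- t)).
by exists C => x Dx; apply: le_trans (ler_norm_negpart _) (fC _ Dx).
Qed.

Lemma measurable_negpartB t : measurable_fun D (fun x => negpart (f x - t)).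
Proof. by apply: measurable_negpart; exact: measurable_funB. Qed.

Lemma integrable_negpart t : m.-integrable D (EFin \o (fun x => negpart (f x - t))).
Proof.
apply: bounded_on_integrable => //; first exact: measurable_negpartB.
exact: bounded_on_negpart.
Qed.

Lemma negpart_Rintegral_dist t t' :
  `|\int[m]_(x in D) negpart (f x - t) - \int[m]_(x in D) negpart (f x - t')| <=
  fine (m D) * `|t - t'|.
Proof.
have it := integrable_negpart.
rewrite -RintegralB//; apply: le_trans (le_normr_Rintegral _ _) _ => //.
  exact: (integrableB mD (it t) (it t')).
rewrite [leRHS]mulrC -Rintegral_cst//; apply: le_Rintegral => //.
- exact: (integrable_abse (integrableB mD (it t) (it t'))).
- exact: finite_measure_integrable_cst.
- move=> x Dx; apply: le_trans (negpart_dist _ _) _.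
  by rewrite (_ : f x - t - (f x - t') = t' - t) 1?distrC//; ring.
Qed.

Lemma continuous_negpart_Rintegral :
  continuous (fun t => \int[m]_(x in D) negpart (f x - t)).
Proof. exact/lipschitz_continuous/negpart_Rintegral_dist. Qed.

End NegpartIntegral.

Section Fubini.
Context {R : realType} d {X : measurableType d}.
Variables (m : {finite_measure set X -> \bar R})
  (la : {finite_measure set R -> \bar R}) (D : set X) (E : set R) (f : X -> R).
Hypotheses (mD : measurable D) (mE : measurable E) (mf : measurable_fun D f)
  (bf : bounded_on D f) (bE : bounded_on E id).

Lemma negpart_Rintegral_swap :
  \int[m]_(x in D) (\int[la]_(t in E) negpart (f x - t)) =
  \int[la]_(t in E) (\int[m]_(x in D) negpart (f x - t)).
Proof.
(* Extension by 0 outside D x E, since f is measurable and bounded only on D. *)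
pose F (z : X * R) := negpart ((f \_ D) z.1 - z.2) * \1_D z.1 * \1_E z.2.
have FE x t : D x -> E t -> F (x, t) = negpart (f x - t).
  by move=> Dx Et; rewrite /F/= patchE !indicE !mem_set//= !mulr1.
have F0 x t : ~ (D x /\ E t) -> F (x, t) = 0.
  move=> h; rewrite /F/= !indicE.
  have [Dx|nDx] := pselect (D x); last by rewrite (memNset nDx) mulr0 mul0r.
  have [Et|nEt] := pselect (E t); last by rewrite (memNset nEt) mulr0.
  by exfalso; exact: h.
have mF : measurable_fun setT F.
  apply: measurable_funM.
    apply: measurable_funM.
      apply: measurable_negpart; apply: measurable_funB => //.
      apply: measurableT_comp => //; apply/(measurable_restrictT _ mD); exact: mf.
    by apply: measurableT_comp => //; exact: measurable_indic.
  by apply: measurableT_comp => //; exact: measurable_indic.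
have bF : bounded_on setT F.
  have [C fC] := bf; have [C' EC'] := bE.
  exists (`|C| + `|C'|) => -[x t] _.
  have [[Dx Et]|h] := pselect (D x /\ E t); last by rewrite F0// normr0 addr_ge0.
  rewrite FE//; apply: le_trans (ler_norm_negpart _) _.
  rewrite (le_trans (ler_normB _ _))// lerD//.
    exact: le_trans (fC _ Dx) (ler_norm _).
  exact: le_trans (EC' _ Et) (ler_norm _).
have iF : (m \x la)%E.-integrable setT (EFin \o F).
  have [C FC] := bF.
  apply: measurable_bounded_integrable => //.
    have mlaT : ((m \x la) setT = m setT * la setT)%E.
      by rewrite -setXTT product_measure1E.
    rewrite [X in (X < _)%E]mlaT lte_mul_pinfty// ?fin_num_measure//.
    by rewrite -ge0_fin_numE// fin_num_measure.
  exists C; split; first exact: num_real.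
  by move=> c Cc z _; exact: le_trans (FC _ I) (ltW Cc).
have := Fubini iF.
have -> : (fun x => \int[la]_t (EFin \o F) (x, t))%E =
    (EFin \o (fun x => \int[la]_(t in E) negpart (f x - t))) \_ D.
  apply/funext => x; rewrite patchE; case: ifPn => [/set_mem Dx|/negP nDx] /=.
    rewrite fineK; last first.
      apply: integrable_fin_num => //.
      apply: bounded_on_integrable => //.
        by apply: measurable_negpart; exact: measurable_funB.
      have [C EC] := bounded_onD (bounded_on_cst E (f x)) (bounded_onZ (-1) bE).
      exists C => t Et; apply: le_trans (ler_norm_negpart _) _.
      by have := EC _ Et; rewrite mulN1r.
    rewrite [RHS]integral_mkcond; apply: eq_integral => t _.
    rewrite patchE; case: ifPn => [/set_mem Et|/negP nEt].
      by rewrite FE.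
    by rewrite F0// => -[_ /mem_set].
  apply: integral0_eq => t _; rewrite F0// => -[/mem_set Dx _]; exact: nDx.
have -> : (fun t => \int[m]_x (EFin \o F) (x, t))%E =
    (EFin \o (fun t => \int[m]_(x in D) negpart (f x - t))) \_ E.
  apply/funext => t; rewrite patchE; case: ifPn => [/set_mem Et|/negP nEt] /=.
    rewrite fineK; last by apply: integrable_fin_num => //; exact: integrable_negpart.
    rewrite [RHS]integral_mkcond; apply: eq_integral => x _.
    rewrite patchE; case: ifPn => [/set_mem Dx|/negP nDx].
      by rewrite FE.
    by rewrite F0// => -[/mem_set].
  apply: integral0_eq => x _; rewrite F0// => -[_ /mem_set Et]; exact: nEt.
by rewrite -!integral_mkcond => h; rewrite /Rintegral; congr fine.
Qed.

End Fubini.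

Section Conull.
Context {R : realType} d {X : measurableType d}.
Variable (m : {measure set X -> \bar R}).

Lemma integral_conull (D : set X) (f : X -> \bar R) : measurable D ->
  m (~` D) = 0%E -> measurable_fun setT f ->
  (\int[m]_x f x = \int[m]_(x in D) f x)%E.
Proof.
move=> mD mDC mf; rewrite [RHS]integral_mkcond; apply: ae_eq_integral => //.
  by apply/(measurable_restrictT _ mD); exact: measurable_funTS.
exists (~` D); split=> //; first exact: measurableC.
by move=> x /= h Dx; apply: h => _; rewrite patchE mem_set.
Qed.

Lemma Rintegral_conull (D : set X) (f : X -> R) : measurable D ->
  m (~` D) = 0%E -> measurable_fun setT f ->
  \int[m]_x f x = \int[m]_(x in D) f x.
Proof.
by move=> mD mDC mf; rewrite /Rintegral (integral_conull mD mDC)//; exact/measurable_EFinP.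
Qed.

End Conull.

Section Benchmark.
Context {R : realType} d {Om : measurableType d} (P : probability Om R)
  (Y : {RV P >-> R}) (a b : R).
Hypothesis Yab : P (Y @^-1` `[a, b]) = 1%E.

Let D := Y @^-1` `[a, b].

Let mD : measurable D.
Proof. by rewrite -[D]setTI; exact: measurable_funP. Qed.

Lemma itv_bnd : bounded_on `[a, b]%classic (@id R).
Proof.
exists (`|a| + `|b|) => x /=; rewrite in_itv/= ler_norml => /andP[ax xb].
have := ler_norm b; have := ler_norm (- a); rewrite normrN.
have := normr_ge0 a; have := normr_ge0 b.
by move=> *; apply/andP; split; lra.
Qed.

(** On the event D of probability 1, Y is bounded, as the Lipschitz estimate for integrals of
    negative parts requires. *)
Lemma benchmarkE eta :
  benchmark Y eta = \int[P]_(om in D) negpart (Y om - eta).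
Proof.
rewrite /benchmark; apply: Rintegral_conull => //.
  by rewrite [LHS](probability_setC P mD) [X in (_ - X)%E]Yab subee.
by apply: measurable_negpart; exact: measurable_funB.
Qed.

Lemma benchmark_continuous : continuous (benchmark Y).
Proof.
rewrite (_ : benchmark Y = fun eta => \int[P]_(om in D) negpart (Y om - eta)).
  apply: continuous_negpart_Rintegral => //; first exact: measurable_funTS.
  have [C h] := itv_bnd; exists C => om Dom; exact: h.
by apply/funext => eta; exact: benchmarkE.
Qed.

End Benchmark.

(** * Weak duality *)

Section WeightedNorm.
Context {R : realType} {T : Type}.
Implicit Types (D : set T) (w h : T -> R).

Lemma wnorm_le D w h C : (forall x, D x -> 0 < w x) ->
  (wnorm D w h <= C%:E)%E -> forall x, D x -> `|h x| <= C * w x.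
Proof.
move=> w0 hC x Dx; rewrite -ler_pdivrMr ?w0// -lee_fin.
by apply: le_trans hC; apply: ereal_sup_ubound; exists x.
Qed.

Lemma wnorm_fin_bound D w h : (forall x, D x -> 0 < w x) ->
  (wnorm D w h < +oo)%E -> exists C, forall x, D x -> `|h x| <= C * w x.
Proof.
move=> w0 hoo; have [D0|/set0P[x0 Dx0]] := eqVneq D set0.
  by exists 0 => x; rewrite D0.
have fin : wnorm D w h \is a fin_num.
  rewrite ge0_fin_numE//; apply: le_trans (_ : (`|h x0| / w x0)%:E <= _)%E.
    by rewrite lee_fin divr_ge0// ltW// w0.
  by apply: ereal_sup_ubound; exists x0.
by exists (fine (wnorm D w h)); apply: wnorm_le => //; rewrite fineK.
Qed.

Lemma wnorm_fin D w h C : (forall x, D x -> 0 < w x) ->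
  (forall x, D x -> `|h x| <= C * w x) -> (wnorm D w h < +oo)%E.
Proof.
move=> w0 hC; apply: le_lt_trans (ltry C); apply: ge_ereal_sup => _ [x Dx <-].
by rewrite lee_fin ler_pdivrMr ?w0// hC.
Qed.

End WeightedNorm.

Section MDP.
Context {R : realType} {dS dA} {S : borelSpaceType R dS}
  {A : borelSpaceType R dA} (M : mdp S A) (a b : R) (y : R -> R).
Hypothesis HM : standing_assumptions M a b y.
Local Notation K := (K M).
Local Notation Q := (Q M).
Local Notation what := (what M).
Local Notation weight := (weight M).

Lemma K_nonempty : K !=set0.
Proof.
have [[pi nu] [P [Plaw _ _]]] := Delta_nonempty HM.
have [K0|/set0P//] := eqVneq K set0.
have := law_K Plaw; rewrite (_ : Kinf M = set0).
  by rewrite measure0 => /eqP; rewrite lt_eqF.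
by rewrite /Kinf K0; apply/seteqP; split=> // om /(_ 0%N).
Qed.

Lemma what_ge1 s : 1 <= what s.
Proof.
rewrite /what lerBrDr gerDl.
(* A state without feasible actions has [sup set0 = 0], hence [what s = 1]. *)
have [->|/set0P E0] := eqVneq [set rew M (s, c) | c in feas M s] set0.
  by rewrite sup0.
by apply: ge_sup => // _ [c sc <-]; apply: (rew_le0 HM (x := (s, c))).
Qed.

Lemma what_gt0 s : 0 < what s.
Proof. exact: lt_le_trans (what_ge1 s). Qed.

(** Links the two weighted spaces: a bound by [what] on S gives a bound by [weight] on K. *)
Lemma what_le_weight x : K x -> what x.1 <= weight x.
Proof.
move=> Kx; rewrite /what /weight lerD2l lerN2; apply: ub_le_sup.
  by exists 0 => _ [c sc <-]; apply: (rew_le0 HM (x := (x.1, c))).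
by exists x.2 => //; case: x Kx.
Qed.

Lemma weight_ge1 x : K x -> 1 <= weight x.
Proof. by move=> Kx; exact: le_trans (what_ge1 _) (what_le_weight Kx). Qed.

Lemma weight_gt0 x : K x -> 0 < weight x.
Proof. by move=> Kx; exact: lt_le_trans (weight_ge1 Kx). Qed.

Lemma norm_rew_le_weight x : K x -> `|rew M x| <= weight x.
Proof.
move=> Kx; rewrite ler0_norm; last exact: (rew_le0 HM).
by rewrite /weight lerDr.
Qed.

(** A supremum over uncountably many actions need not be Borel; measurability is extracted from the
    integrability assumption at some point of K. *)
Lemma measurable_what : measurable_fun setT what.
Proof.
have [x Kx] := K_nonempty.
exact/measurable_EFinP/(measurable_int _ (Q_what_integrable HM Kx)).
Qed.

Lemma measurable_weight : measurable_fun K weight.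
Proof. by apply: measurable_funB => //; exact: rew_measurable. Qed.

Lemma integrable_what_bound (h : S -> R) C x : K x -> measurable_fun setT h ->
  (forall s, `|h s| <= C * what s) -> (Q x).-integrable setT (EFin \o h).
Proof.
move=> Kx mh hC.
apply: (@le_integrable _ _ _ _ _ _ _ (fun s => C%:E * (what s)%:E)%E) => //.
- exact/measurable_EFinP.
- move=> s _ /=; rewrite lee_fin (le_trans (hC s))//.
  exact: le_trans (ler_norm _) _.
- by apply: integrableZl => //; exact: (Q_what_integrable HM).
Qed.

Section Measure.
Variable m : {finite_measure set (S * A)%type -> \bar R}.
Hypotheses (mKC : m (~` K) = 0%E) (iw : m.-integrable K (EFin \o weight))
  (balance : forall B, measurable B ->
    (m (fst @^-1` B) = \int[m]_(x in K) Q x B)%E).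
Let mK : measurable K := K_measurable M.

Lemma integrable_weight_bound (f : S * A -> R) C : measurable_fun K f ->
  (forall x, K x -> `|f x| <= C * weight x) -> m.-integrable K (EFin \o f).
Proof.
move=> mf fC.
apply: (@le_integrable _ _ _ _ _ _ _ (fun x => C%:E * (weight x)%:E)%E) => //.
- exact/measurable_EFinP.
- move=> s Ks /=; rewrite lee_fin (le_trans (fC s Ks))//.
  exact: le_trans (ler_norm _) _.
- exact: integrableZl.
Qed.

(** For g >= 0 the balance identity holds in the extended reals. The bound by [what], hence by the
    weight on K, makes one side finite, and the identity then makes the other side integrable. *)
Let what_balance_ge0 (g : S -> R) C : measurable_fun setT g ->
  (forall s, 0 <= g s) -> (forall s, `|g s| <= C * what s) ->
  [/\ m.-integrable K (EFin \o (fun x => g x.1)),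
    m.-integrable K (EFin \o (fun x => \int[Q x]_s g s)) &
    \int[m]_(x in K) g x.1 = \int[m]_(x in K) \int[Q x]_s g s].
Proof.
move=> mg g0 gC.
have C0 : 0 <= C.
  have [x _] := K_nonempty; rewrite -(pmulr_lge0 _ (what_gt0 x.1)).
  by apply: le_trans (gC _).
have mg1 : measurable_fun setT (fun x : S * A => g x.1).
  by apply: measurableT_comp => //; exact: measurable_fst.
have ig : m.-integrable K (EFin \o (fun x => g x.1)).
  apply: (@integrable_weight_bound _ C); first exact: measurable_funTS.
  move=> x Kx; apply: le_trans (gC _) _.
  by rewrite ler_wpM2l// what_le_weight.
have Qg x : K x -> ((\int[Q x]_s g s)%:E = \int[Q x]_s (g s)%:E)%E.
  move=> Kx; rewrite fineK//; apply: integrable_fin_num => //.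
  exact: integrable_what_bound gC.
have eqE : (\int[m]_(x in K) (g x.1)%:E =
    \int[m]_(x in K) (\int[Q x]_s g s)%:E)%E.
  rewrite -(@integral_conull _ _ _ m K (fun x => (g x.1)%:E))//; last exact/measurable_EFinP.
  rewrite (@ge0_integral_balance _ _ _ _ _ M m balance (EFin \o g))//.
  - by apply: eq_integral => x /set_mem Kx; rewrite Qg.
  - exact/measurable_EFinP.
split=> //; last by rewrite /Rintegral; congr fine; exact: eqE.
apply/integrableP; split.
  apply: (@eq_measurable_fun _ _ _ _ _ (fun x => \int[Q x]_s (g s)%:E)%E).
    by move=> x /set_mem Kx /=; rewrite Qg.
  apply: measurable_integral_Q; [by move=> s; rewrite lee_fin|exact/measurable_EFinP].
rewrite (eq_integral (fun x => (\int[Q x]_s g s)%:E)); last first.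
  by move=> x _; rewrite /= ger0_norm// Rintegral_ge0.
rewrite -eqE; move/integrableP : ig => [_]; apply: le_lt_trans.
by apply: ge0_le_integral => //= [x _|||x _]; rewrite ?lee_fin//;
  [exact/measurable_EFinP/measurable_funTS|
  exact/measurable_EFinP/measurableT_comp/measurable_funTS|exact: ler_norm].
Qed.

(** The sign required by [what_balance_ge0] is obtained from h = (h + C what) - C what, a difference
    of nonnegative functions bounded by multiples of [what]. *)
Lemma integral_L0star (h : S -> R) : Fspace setT what h ->
  m.-integrable K (EFin \o L0star M h) /\ \int[m]_(x in K) L0star M h x = 0.
Proof.
move=> [mh /wnorm_fin_bound hoo].
have {hoo}[|C hC] := hoo; first by move=> s _; exact: what_gt0.
have {}hC s : `|h s| <= C * what s by exact: hC.
pose g1 s := h s + C * what s; pose g2 s := C * what s.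
have g2_0 s : 0 <= g2 s by apply: le_trans (hC s).
have mg2 : measurable_fun setT g2 by apply: measurable_funM => //; exact: measurable_what.
have mg1 : measurable_fun setT g1 by exact: measurable_funD.
have g1_0 s : 0 <= g1 s by have := hC s; rewrite ler_norml /g1 => /andP[h1 _]; lra.
have g2C s : `|g2 s| <= C * what s by rewrite ger0_norm.
have g1C s : `|g1 s| <= (C + C) * what s.
  by rewrite mulrDl /g1 (le_trans (ler_normD _ _))// lerD// g2C.
have [i1 i1' e1] := what_balance_ge0 mg1 g1_0 g1C.
have [i2 i2' e2] := what_balance_ge0 mg2 g2_0 g2C.
have LE x : K x -> L0star M h x =
    (g1 x.1 - g2 x.1) - (\int[Q x]_s g1 s - \int[Q x]_s g2 s).
  move=> Kx; rewrite /L0star -RintegralB//.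
  - rewrite /g1 addrK; congr (_ - _); apply: eq_Rintegral => s _.
    by rewrite addrK.
  - exact: integrable_what_bound g1C.
  - exact: integrable_what_bound g2C.
have iB := integrableB mK (integrableB mK i1 i2) (integrableB mK i1' i2').
split.
  by apply: eq_integrable iB => // x /set_mem Kx /=; rewrite LE.
rewrite (@eq_Rintegral _ _ _ m K (fun x =>
  (g1 x.1 - g2 x.1) - (\int[Q x]_s g1 s - \int[Q x]_s g2 s))); last first.
  by move=> x /set_mem Kx; rewrite LE.
rewrite RintegralB//; [|exact: (integrableB mK i1 i2)|exact: (integrableB mK i1' i2')].
by rewrite !RintegralB// e1 e2 subrr.
Qed.

End Measure.
End MDP.

Section ShiftedNegpart.
Context {R : realType} (a b : R).
Variable la : {finite_measure set R -> \bar R}.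
Let E : set R := `[a, b]%classic.
Let mE : measurable E. Proof. exact: measurable_itv. Qed.

(** This is [L1star] as a function of the value t of z. *)
Definition negpart_transform (t : R) : R := \int[la]_(eta in E) negpart (t - eta).

Lemma negpart_transform_dist t t' :
  `|negpart_transform t - negpart_transform t'| <= fine (la E) * `|t - t'|.
Proof.
pose f (eta : R) := - eta.
have mN : measurable_fun E f by exact: measurable_funN.
have bN : bounded_on E f.
  by have [C h] := itv_bnd a b; exists C => eta Et; rewrite normrN; exact: h.
have e s : (fun eta => negpart (f eta - - s)) = (fun eta => negpart (s - eta)).
  by apply/funext => eta; rewrite opprK addrC.
have := negpart_Rintegral_dist la mE mN bN (- t) (- t').
rewrite /negpart_transform !e (_ : - t - - t' = - (t - t')) ?normrN//.
by ring.
Qed.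

Lemma negpart_transform_continuous : continuous negpart_transform.
Proof. exact/lipschitz_continuous/negpart_transform_dist. Qed.

End ShiftedNegpart.

Section ContinuousItv.
Context {R : realType} (a b : R).

Lemma continuous_bnd_itv (f : R -> R) : continuous f -> bounded_on `[a, b]%classic f.
Proof.
move=> cf; have [C [_ hC]] : bounded_set (f @` `[a, b]).
  apply: compact_bounded; apply: continuous_compact.
    exact: continuous_subspaceT.
  exact: segment_compact.
exists (C + 1) => x abx; apply: (hC (C + 1)); first by rewrite ltrDl.
by exists x.
Qed.

Lemma continuous_integrable_itv (la : {finite_measure set R -> \bar R})
    (f : R -> R) : continuous f -> la.-integrable `[a, b]%classic (EFin \o f).
Proof.
move=> cf; apply: bounded_on_integrable; [exact: measurable_itv| |exact: continuous_bnd_itv].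
by apply: measurable_funTS; exact: continuous_measurable_fun.
Qed.

End ContinuousItv.

Section WeakDuality.
Context {R : realType} {dS dA} {S : borelSpaceType R dS}
  {A : borelSpaceType R dA} (M : mdp S A) (a b : R) (y : R -> R).
Hypothesis HM : standing_assumptions M a b y.
Local Notation K := (K M).
Local Notation Q := (Q M).

Lemma zf_bnd : bounded_on K (zf M). Proof. exact: zf_bounded HM. Qed.

Lemma primal_feasible_measure mu : primal_feasible M a b y mu ->
  exists m : {finite_measure set (S * A)%type -> \bar R},
  [/\ m (~` K) = 0%E, m K = 1%E, m.-integrable K (EFin \o weight M),
    forall B, measurable B -> (m (fst @^-1` B) = \int[m]_(x in K) Q x B)%E &
    (forall eta, a <= eta <= b ->
       y eta <= \int[m]_(x in K) negpart (zf M x - eta)) /\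
    primal_objective M mu = \int[m]_(x in K) rew M x].
Proof.
move=> [[muK wfin] mu0 L0mu mu1 L1mu].
have mK := K_measurable M.
have [m [mE cE tE]] := charge_ge0_measure mu0.
have m1 : m K = 1%E.
  move: mu1; rewrite /pairing cE Rintegral_cst// mul1r => m1.
  by rewrite -[LHS]fineK ?fin_num_measure// m1.
exists m; split => //.
- rewrite [LHS]mE; last exact: measurableC.
  by apply: (muK _ (measurableC mK)); exact: setICl.
- apply/integrableP; split; first by apply/measurable_EFinP; exact: measurable_weight.
  rewrite (eq_integral (fun x => (weight M x)%:E)) -?tE//.
  by move=> x /set_mem Kx /=; rewrite ger0_norm// ltW// (weight_gt0 HM).
- move=> B mB.
  have mfst : measurable (fst @^-1` B : set (S * A)).
    by rewrite -[X in measurable X]setTI; exact: measurable_fst.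
  have /eqP := L0mu B mB; rewrite /L0 /pairing cE subr_eq0 -mE// => /eqP L0B.
  rewrite -[LHS]fineK ?fin_num_measure// L0B.
  (* [L0] involves [fine] twice; the identity lifts to extended reals because Q x B <= 1 and m K = 1
     make the integral finite. *)
  have QE : (\int[m]_(x in K) (fine (Q x B))%:E = \int[m]_(x in K) Q x B)%E.
    by apply: eq_integral => x _; rewrite fineK ?fin_num_measure.
  rewrite /Rintegral -[RHS]fineK ?QE// ge0_fin_numE; last first.
    by apply: integral_ge0 => x _.
  apply: le_lt_trans (_ : \int[m]_(x in K) 1 < _)%E.
    apply: ge0_le_integral => //; first exact: Q_measurable.
    by move=> x _; exact: probability_le1.
  by rewrite integral_cst// mul1e [X in (X < _)%E]m1 ltry.
- by split=> [eta aeb|]; [have := L1mu _ aeb; rewrite /L1 /pairing cE|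
    rewrite /primal_objective /pairing cE].
Qed.

Lemma L1starE (la : {finite_measure set R -> \bar R}) L x :
  (forall D f, cintegral L D f = \int[la]_(t in D) f t) ->
  L1star M a b L x = negpart_transform a b la (zf M x).
Proof. by move=> LE; rewrite /L1star LE. Qed.

Lemma measurable_negpart_transform (la : {finite_measure set R -> \bar R}) :
  measurable_fun K (fun x => negpart_transform a b la (zf M x)).
Proof.
apply: measurableT_comp; last exact: zf_measurable.
by apply: continuous_measurable_fun; exact: negpart_transform_continuous.
Qed.

Lemma bounded_on_negpart_transform (la : {finite_measure set R -> \bar R}) :
  bounded_on K (fun x => negpart_transform a b la (zf M x)).
Proof.
have [C zC] := zf_bnd; set g := negpart_transform a b la.
exists (fine (la `[a, b]%classic) * C + `|g 0|) => x Kx.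
rewrite -[g _](subrK (g 0)) (le_trans (ler_normD _ _))// lerD2r.
apply: le_trans (negpart_transform_dist _ _ _ _ _) _.
by rewrite subr0 ler_wpM2l ?zC// fine_ge0.
Qed.

Theorem weak_duality mu v : continuous y ->
  primal_feasible M a b y mu -> dual_feasible M a b v ->
  primal_objective M mu <= dual_objective a b y v.
Proof.
move=> cy /primal_feasible_measure[m [mKC mK1 iw bal [yL ->]]] [hF _ Lpos vK].
have mK := K_measurable M.
have [la [_ laE _]] := charge_ge0_measure Lpos.
rewrite /dual_objective laE.
set h := dp_h v in hF vK *; set beta := dp_beta v in vK *.
have [iL L0] := integral_L0star HM mKC iw bal hF.
pose g := negpart_transform a b la \o zf M.
have ig : m.-integrable K (EFin \o g).
  apply: bounded_on_integrable => //; first exact: measurable_negpart_transform.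
  exact: bounded_on_negpart_transform.
have ir : m.-integrable K (EFin \o rew M).
  apply: (integrable_weight_bound (C := 1) iw); first exact: rew_measurable.
  by move=> x Kx; rewrite mul1r (norm_rew_le_weight HM).
have ib : m.-integrable K (EFin \o cst beta) by exact: finite_measure_integrable_cst.
have i1 := integrableD mK ir iL.
have i2 := integrableB mK i1 ib.
have le0 : \int[m]_(x in K) (rew M x + L0star M h x - beta + g x) <= 0.
  rewrite -[leRHS](_ : \int[m]_(x in K) 0 = 0); last by rewrite Rintegral_cst// mul0r.
  apply: le_Rintegral => //.
  - exact: (integrableD mK i2 ig).
  - exact: finite_measure_integrable_cst.
  - by move=> x Kx; have := vK x Kx; rewrite (L1starE _ laE).
have swap : \int[m]_(x in K) g x =
    \int[la]_(eta in `[a, b]) \int[m]_(x in K) negpart (zf M x - eta).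
  apply: negpart_Rintegral_swap => //; [exact: zf_measurable|exact: zf_bnd|].
  exact: itv_bnd.
have le1 : \int[la]_(eta in `[a, b]) y eta <= \int[m]_(x in K) g x.
  rewrite swap; apply: le_Rintegral => //.
  - exact: continuous_integrable_itv.
  - apply: continuous_integrable_itv; apply: continuous_negpart_Rintegral => //.
      exact: zf_measurable.
    exact: zf_bnd.
move: le0; rewrite RintegralD// RintegralB// RintegralD// L0 addr0.
rewrite Rintegral_cst// (congr1 fine mK1) mulr1. lra.
Qed.

End WeakDuality.

(** * Existence of a primal solution *)

Section FiniteMeasureOf.
Context {R : realType} d {T : measurableType d}.
Variable m : {measure set T -> \bar R}.
Hypothesis moo : (m setT < +oo)%E.

Let mm B := m B.
Let mm0 : mm set0 = 0%E. Proof. exact: measure0. Qed.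
Let mm_ge0 B : (0 <= mm B)%E. Proof. exact: measure_ge0. Qed.
Let mm_sigma : semi_sigma_additive mm.
Proof. exact: measure_semi_sigma_additive. Qed.

HB.instance Definition _ := isMeasure.Build d T R mm mm0 mm_ge0 mm_sigma.

Let mm_fin : fin_num_fun mm.
Proof.
move=> B mB; rewrite ge0_fin_numE//; apply: le_lt_trans moo.
by apply: le_measure; rewrite ?inE.
Qed.

HB.instance Definition _ := Measure_isFinite.Build d T R mm mm_fin.

Lemma finite_measure_of : exists m' : {finite_measure set T -> \bar R},
  forall B, m' B = m B.
Proof. by exists mm. Qed.

End FiniteMeasureOf.

Section DiscreteMeasure.
Context {R : realType}.

Lemma Rintegral_mscale d (T : measurableType d) (m : {measure set T -> \bar R})
    (c : {nonneg R}) (D : set T) (f : T -> R) : measurable D ->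
  m.-integrable D (EFin \o f) ->
  \int[mscale c m]_(x in D) f x = c%:num * \int[m]_(x in D) f x.
Proof.
move=> mD mf; have mEf := measurable_int _ mf.
have -> : c%:num = fine (c%:num%:E) by [].
rewrite /Rintegral -fineM//; last exact: integrable_fin_num.
congr fine.
rewrite (integralE (mscale c m) D (EFin \o f)) (integralE m D (EFin \o f)).
rewrite muleBr//; last exact: integrable_add_def.
by congr (_ - _)%E; apply: ge0_integral_mscale => //;
  [exact: measurable_funepos|exact: measurable_funeneg].
Qed.

(** Turns the finitely many weighted points of a cone element into the component Lambda of a dual
    point. *)
Lemma discrete_measure (E : set R) (s : seq (R * R)) : measurable E ->
  (forall p, p \in s -> 0 <= p.1 /\ E p.2) ->
  exists la : {finite_measure set R -> \bar R}, la (~` E) = 0%E /\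
    forall f, measurable_fun setT f -> bounded_on E f ->
      \int[la]_(x in E) f x = \sum_(p <- s) p.1 * f p.2.
Proof.
move=> mE; elim: s => [_|[c e] s ih sP].
  exists mzero; split=> // f _ _; rewrite big_nil.
  by rewrite /Rintegral integral_measure_zero.
have [|la [laE laf]] := ih; first by move=> p ps; apply: sP; rewrite inE ps orbT.
have [/= c0 Ee] := sP (c, e) (mem_head _ _).
pose m1 : {measure set R -> \bar R} := mscale (NngNum c0) (dirac e).
pose m2 : {measure set R -> \bar R} := measure_add m1 la.
have m2E (B : set R) : m2 B = (c%:E * (\1_B e)%:E + la B)%E by exact: (measure_addE m1 la B).
have m2oo : (m2 setT < +oo)%E.
  rewrite [X in (X < _)%E]m2E lte_add_pinfty// ?ltry// -ge0_fin_numE//.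
  exact: fin_num_measure.
have [m m_m2] := finite_measure_of m2oo; exists m; split.
  by rewrite m_m2 m2E [X in (_ + X)%E]laE indicE memNset//= ?mule0 ?adde0.
move=> f mf bf; rewrite big_cons /= -laf//.
have mfE : measurable_fun E f by exact: measurable_funTS.
have i1 : (dirac e : {finite_measure set R -> \bar R}).-integrable E (EFin \o f).
  exact: bounded_on_integrable.
have i1' : m1.-integrable E (EFin \o f).
  exact: (bounded_on_integrable (mscale (NngNum c0) (dirac e)) mE mfE bf).
have i2 : la.-integrable E (EFin \o f) by exact: bounded_on_integrable.
have -> : \int[m]_(x in E) f x = \int[m2]_(x in E) f x.
  rewrite /Rintegral; congr fine.
  by apply: eq_measure_integral => B _ _; rewrite m_m2.
rewrite {1}/Rintegral integral_measure_add// fineD; [|exact: integrable_fin_num..].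
congr (_ + _); rewrite -/(Rintegral m1 E f) Rintegral_mscale//=.
rewrite /Rintegral integral_dirac//; last exact/measurable_EFinP.
by rewrite diracE mem_set// mul1e.
Qed.

End DiscreteMeasure.

Section SuperlevelSets.
Context {R : realType}.

Lemma usc_closed_superlevel (T : topologicalType) (D : set T) (f : T -> R) c :
  closed D -> upper_semicontinuous_on D f -> closed (D `&` [set x | c <= f x]).
Proof.
move=> cD uf; rewrite -[X in closed X]setCK; apply: open_closedC.
rewrite openE => x nx; change (nbhs x (~` (D `&` [set x | c <= f x]))).
have [Dx|nDx] := pselect (D x); last first.
  have : nbhs x (~` D) by apply: open_nbhs_nbhs; split=> //; exact: closed_openC.
  by apply: filterS => z nDz [].
have fxc : f x < c by rewrite ltNge; apply/negP => h; apply: nx.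
have : nbhs x [set z | D z -> f z < c] by exact: (uf x c Dx fxc).
by apply: filterS => z h [/h]; rewrite /= ltNge => /negP.
Qed.

Lemma within_continuous_usc (T : topologicalType) (D : set T) (f : T -> R) :
  {within D, continuous f} -> upper_semicontinuous_on D f.
Proof.
move=> cf x c Dx fxc.
have /(_ [set t | t < c]) := cf x.
have -> : nbhs (f x) [set t | t < c] = True.
  by apply/propext; split=> // _; exact: lt_nbhsl.
by move=> /(_ I); rewrite /nbhs/= nbhs_subspace_in.
Qed.

End SuperlevelSets.

Section BorelMoment.
Context {R : realType} {dS dA} {S : borelSpaceType R dS}
  {A : borelSpaceType R dA}.
Variables (K : set (S * A)) (G : set (S * A -> R)).
Hypothesis cK : closed K.
Lemma closed_prod_measurable (F : set (S * A)) : closed F -> measurable F.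
Proof.
move=> cF; rewrite -[F]setCK; apply: measurableC.
by apply: borelSpace_prod_measurable_open; exact: closed_openC.
Qed.

Let mK : measurable K. Proof. exact: closed_prod_measurable. Qed.

Lemma closed_superlevel_measurable (f : S * A -> R) :
  (forall c, closed (K `&` [set x | c <= f x])) -> measurable_fun K f.
Proof.
move=> cf; apply: (measurability _ (RGenCInfty.measurableE R)).
move=> _ [_ [c ->] <-].
rewrite (_ : _ `&` _ = K `&` [set x | c <= f x]); last first.
  by apply/seteqP; split=> x [Kx] /=; rewrite in_itv/= andbT.
exact: closed_prod_measurable.
Qed.

(** P dominates l on each closed superlevel set of f, so the layer cake bound carries 0 <= l f over
    to the integral. The bounded f stands in for a g that may be unbounded below. *)
Lemma moment_probability : convex_cone G ->
  (forall g (e : R), G g -> 0 < e -> ~ (forall x, K x -> g x <= - e)) ->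
  (forall e : R, 0 < e -> exists C g, [/\ compact C, G g &
     forall x, K x -> g x <= e - 1 + \1_C x]) ->
  exists P : probability (S * A)%type R, P K = 1%E /\
    forall f g, bounded_on K f -> G g -> (forall x, K x -> g x <= f x) ->
      (forall c, closed (K `&` [set x | c <= f x])) ->
      0 <= \int[P]_(x in K) f x.
Proof.
move=> GG Gneg tight.
have [l [mu [pl lG car mu1 lmu]]] :=
  @cone_outer_measure R (S * A)%type K G (@borelSpace_prod_hausdorff _ _ _ S A)
    GG Gneg tight.
have [P PE] : exists P : probability (S * A)%type R, forall B, P B = mu B.
  apply: outer_measure_probability => // B mB.
  by apply: car; exact: borelSpace_prod_measurableE.
have PK : P K = 1%E.
  suff h : (1 <= mu K)%E.
    by apply/eqP; rewrite eq_le probability_le1//=; move: h; rewrite -PE.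
  apply: le_trans (lmu _ cK); rewrite lee_fin -(pf1 pl); apply: pf_le pl _ _ _ => //.
  - exact: (bounded_on_cst K 1).
  - exact: bounded_on_indic.
  - by move=> x Kx; rewrite indicE mem_set.
exists P; split=> // f g bf Gg gf cf; apply: le_trans (lG _ _ bf Gg gf) _.
apply: positive_functional_le_Rintegral => //.
  exact: closed_superlevel_measurable.
move=> c; have := lmu _ (cf c); rewrite -PE -lee_fin fineK//.
by apply: fin_num_measure; apply: closed_prod_measurable.
Qed.

End BorelMoment.

Lemma EFin_Rintegral {R : realType} d (T : measurableType d)
    (m : {measure set T -> \bar R}) (D : set T) (f : T -> R) : measurable D ->
  m.-integrable D (EFin \o f) ->
  ((\int[m]_(x in D) f x)%:E = \int[m]_(x in D) (f x)%:E)%E.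
Proof. by move=> mD fi; rewrite fineK//; exact: integrable_fin_num. Qed.

Lemma bounded_cvg_integral {R : realType} d (T : measurableType d)
    (m : {finite_measure set T -> \bar R}) (D : set T) (f_ : nat -> T -> R)
    (f : T -> R) (C : R) : measurable D ->
  (forall n, measurable_fun D (f_ n)) ->
  (forall n x, D x -> `|f_ n x| <= C) ->
  (forall x, D x -> f_ n x @[n --> \oo] --> f x) ->
  (\int[m]_(x in D) (f_ n x)%:E @[n --> \oo] --> \int[m]_(x in D) (f x)%:E)%E.
Proof.
move=> mD mf_ fC ff.
apply: (@dominated_cvg _ _ _ m D mD (fun n => EFin \o f_ n) (EFin \o f)
  (EFin \o cst C)).
- by move=> n; apply/measurable_EFinP.
- by move=> x Dx; apply/cvg_EFin; [exact: nearW|exact: ff].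
- by [].
- exact: (finite_measure_integrable_cst m C mD).
- by move=> n x Dx; rewrite lee_fin; exact: fC.
Qed.

(** * From continuous test functions to the balance equation on Borel sets *)

Section Balance.
Context {R : realType} {dS dA} {S : borelSpaceType R dS}
  {A : borelSpaceType R dA} (M : mdp S A).
Local Notation K := (K M).
Local Notation Q := (Q M).
Variable P : probability (S * A)%type R.
Hypothesis PK : P K = 1%E.
Hypothesis balance_continuous : forall h : S -> R, continuous h ->
  bounded_on setT h ->
  \int[P]_(x in K) h x.1 = \int[P]_(x in K) \int[Q x]_s h s.

Let mK : measurable K := K_measurable M.

Lemma probability_conull : P (~` K) = 0%E.
Proof. by rewrite [LHS](probability_setC P mK) [X in (_ - X)%E]PK subee. Qed.

Let mfst (B : set S) : measurable B -> measurable (fst @^-1` B : set (S * A)).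
Proof. by move=> mB; rewrite -[X in measurable X]setTI; exact: measurable_fst. Qed.

(** Continuous approximations of the indicator of F and dominated convergence, first under each
    [Q x], then under P on both sides. *)
Let balance_closed F : closed F ->
  (P (fst @^-1` F) = \int[P]_(x in K) Q x F)%E.
Proof.
move=> cF; have [phi [cphi phi01 phiF]] := borelSpace_closed_approx cF.
have mF : measurable F.
  by rewrite -[F]setCK; apply/measurableC/borelSpace_measurable_open/closed_openC.
have mphi n : measurable_fun setT (phi n) by exact: borelSpace_continuous_measurable.
have phi1 n s : `|phi n s| <= 1.
  by have /andP[h0 h1] := phi01 n s; rewrite ger0_norm.
have phi_cvg s : phi n s @[n --> \oo] --> (\1_F s : R).
  by apply: cvg_near_cst; apply: filterS (phiF s).
have bphi n : bounded_on setT (phi n) by exists 1 => s _; exact: phi1.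
have Qphi x n : (\int[Q x]_s (phi n s)%:E = (\int[Q x]_s phi n s)%:E)%E.
  rewrite fineK//; apply: integrable_fin_num => //.
  exact: (bounded_on_integrable (Q x) measurableT (mphi n) (bphi n)).
have Qphi_cvg x : \int[Q x]_s phi n s @[n --> \oo] --> fine (Q x F).
  have := @bounded_cvg_integral _ _ _ (Q x) setT phi (\1_F) 1 measurableT mphi
    (fun n s _ => phi1 n s) (fun s _ => phi_cvg s).
  rewrite integral_indic// setIT.
  under eq_fun do rewrite Qphi.
  move=> h; suff : ((\int[Q x]_s phi n s)%:E @[n --> \oo] --> (fine (Q x F))%:E)%E.
    by move/fine_cvg.
  by rewrite fineK; [exact: h|exact: fin_num_measure].
have Qphi1 n x : `|\int[Q x]_s phi n s| <= 1.
  apply: le_trans (le_normr_Rintegral _ _) _ => //.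
    exact: (bounded_on_integrable (Q x) measurableT (mphi n) (bphi n)).
  have -> : 1 = \int[Q x]_s 1.
    by rewrite Rintegral_cst// mul1r (congr1 fine (@probability_setT _ _ _ (Q x))).
  apply: le_Rintegral => //.
  - exact: (integrable_abse (bounded_on_integrable (Q x) measurableT (mphi n) (bphi n))).
  - exact: (finite_measure_integrable_cst (Q x) 1 measurableT).
have mQphi n : measurable_fun K (fun x => \int[Q x]_s phi n s).
  apply: measurableT_comp => //; apply: measurable_integral_Q.
    by move=> s; rewrite lee_fin; have /andP[] := phi01 n s.
  exact/measurable_EFinP.
have lhs := @bounded_cvg_integral _ _ _ P K (fun n x => phi n x.1)
  (fun x => \1_F x.1) 1 mK.
have rhs := @bounded_cvg_integral _ _ _ P K (fun n x => \int[Q x]_s phi n s)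
  (fun x => fine (Q x F)) 1 mK.
have {}lhs : (\int[P]_(x in K) (phi n x.1)%:E @[n --> \oo] --> P (fst @^-1` F))%E.
  have <- : (\int[P]_(x in K) (\1_F x.1)%:E = P (fst @^-1` F))%E.
    rewrite -integral_conull//; first last.
    - apply/measurable_EFinP; apply: measurableT_comp.
        exact: measurable_indic.
      exact: measurable_fst.
    - exact: probability_conull.
    rewrite (_ : (fun x => _) = EFin \o \1_(fst @^-1` F)); last first.
      by apply/funext => x /=; rewrite !indicE; congr ((_ : bool)%:R)%:E;
        apply/idP/idP => /set_mem h; exact/mem_set.
    by rewrite integral_indic ?setIT//; exact: mfst.
  apply: lhs => //.
  - by move=> n; apply: measurable_funTS; apply: measurableT_comp => //; exact: measurable_fst.
have {}rhs : (\int[P]_(x in K) (\int[Q x]_s phi n s)%:E @[n --> \oo] -->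
    \int[P]_(x in K) Q x F)%E.
  have <- : (\int[P]_(x in K) (fine (Q x F))%:E = \int[P]_(x in K) Q x F)%E.
    by apply: eq_integral => x _; rewrite fineK ?fin_num_measure.
  exact: rhs.
have E n : (\int[P]_(x in K) (phi n x.1)%:E =
    \int[P]_(x in K) (\int[Q x]_s phi n s)%:E)%E.
  rewrite -!EFin_Rintegral// ?balance_continuous//.
  - apply: (bounded_on_integrable P mK (mQphi n)).
    by exists 1 => x _; exact: Qphi1.
  - apply: (bounded_on_integrable P mK); last by exists 1 => x _; exact: phi1.
    by apply: measurable_funTS; apply: measurableT_comp => //; exact: measurable_fst.
apply: cvg_unique lhs _ => //.
by apply: cvg_trans rhs; apply: near_eq_cvg; apply: nearW => n; rewrite E.
Qed.

(** Both sides are probabilities in B that agree on closed sets, hence on open sets, which form a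
    generating class stable under intersection. *)
Lemma balance_measurable B : measurable B ->
  (P (fst @^-1` B) = \int[P]_(x in K) Q x B)%E.
Proof.
have mfstT : measurable_fun setT (fst : S * A -> S) by exact: measurable_fst.
pose mfst1 : {measure set S -> \bar R} := pushforward P (fst : S * A -> S).
pose m1 := mfst1 mfstT.
pose m2 : {measure set S -> \bar R} := kcomp (constker P) (Qker M) tt.
have m2E C : (m2 C = \int[P]_(x in K) Q x C)%E.
  rewrite /m2/= /kcomp [RHS]integral_mkcond; apply: eq_integral => x _.
  rewrite patchE; case: (boolP (x \in K)) => [/set_mem Kx|/negP nKx].
    exact: Qker_in.
  by apply: Qker_notin => /mem_set.
move=> mB; rewrite -m2E -[LHS]/(m1 B).
apply: (@measure_unique _ _ _ (@open S) (fun=> setT) (@borel_measurable _ _ S)) => //.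
- by move=> U V oU oV; exact: openI.
- by move=> _; exact: openT.
- by apply/seteqP; split=> // s _; exists 0%N.
- move=> U oU.
  have mU := borelSpace_measurable_open oU.
  have m1T : m1 setT = 1%E by rewrite /m1/= /pushforward preimage_setT probability_setT.
  have m2T : m2 setT = 1%E.
    rewrite m2E (eq_integral (cst 1%E)); last by move=> x _; rewrite /= probability_setT.
    by rewrite integral_cst// mul1e; exact: PK.
  have m12 : m1 (~` U) = m2 (~` U).
    by rewrite m2E; apply: balance_closed; exact: open_closedC.
  have c (m : {measure set S -> \bar R}) : m setT = 1%E -> m U = (1 - m (~` U))%E.
    move=> mT; rewrite -mT -[X in m X = _]setCK -setTD measureD ?setTI//.
      exact: measurableC.
    by rewrite [X in (X < _)%E](_ : _ = 1%E) ?ltry.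
  by rewrite (c m1 m1T) (c m2 m2T) m12.
- by move=> _; rewrite [X in (X < _)%E](_ : _ = 1%E) ?ltry//; exact: probability_setT.
Qed.

End Balance.

Lemma continuous_scale {R : realType} (T : topologicalType) (c : R)
    (h : T -> R) : continuous h -> continuous (fun s => c * h s).
Proof. by move=> ch s; apply: continuousM; [exact: cvg_cst|exact: ch]. Qed.

Section PrimalExistence.
Context {R : realType} {dS dA} {S : borelSpaceType R dS}
  {A : borelSpaceType R dA} (M : mdp S A) (a b : R) (y : R -> R).
Hypotheses (HM : standing_assumptions M a b y) (cy : continuous y).
Variable d : R.
Hypothesis d_le : forall v, dual_feasible M a b v -> d <= dual_objective a b y v.
Local Notation K := (K M).
Local Notation Q := (Q M).
Local Notation r := (rew M).
Local Notation z := (zf M).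

Let mK : measurable K := K_measurable M.

Let integrable_bc (h : S -> R) x : continuous h -> bounded_on setT h ->
  (Q x).-integrable setT (EFin \o h).
Proof.
move=> ch bh; apply: (bounded_on_integrable (Q x) measurableT _ bh).
exact: borelSpace_continuous_measurable.
Qed.

Lemma L0starD (h1 h2 : S -> R) x : continuous h1 -> bounded_on setT h1 ->
  continuous h2 -> bounded_on setT h2 ->
  L0star M (fun s => h1 s + h2 s) x = L0star M h1 x + L0star M h2 x.
Proof.
move=> c1 b1 c2 b2; rewrite /L0star RintegralD//; [|exact: integrable_bc..].
by rewrite opprD addrACA.
Qed.

Lemma L0starZ c (h : S -> R) x : continuous h -> bounded_on setT h ->
  L0star M (fun s => c * h s) x = c * L0star M h x.
Proof.
by move=> ch bh; rewrite /L0star RintegralZl// ?mulrBr//; exact: integrable_bc.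
Qed.

Definition nonneg_weights (s : seq (R * R)) :=
  forall p, p \in s -> 0 <= p.1 /\ a <= p.2 <= b.

(** Such functions have nonnegative integral against every feasible measure of value at least d.
    Finite lists of (weight, eta) play the role of Lambda; h ranges over a linear space, which
    yields an equality constraint. *)
Definition constraint_cone : set (S * A -> R) := [set g | exists t h s,
  [/\ 0 <= t, continuous h, bounded_on setT h, nonneg_weights s &
    g = fun x => t * (r x - d) + L0star M h x +
      \sum_(p <- s) p.1 * (negpart (z x - p.2) - y p.2)]].

Lemma L0star_cone h : continuous h -> bounded_on setT h ->
  constraint_cone (L0star M h).
Proof.
move=> ch bh; exists 0, h, [::]; split=> //.
by apply/funext => x; rewrite mul0r add0r big_nil addr0.
Qed.

Let L0star0 x : L0star M (cst 0) x = 0.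
Proof. by rewrite /L0star Rintegral_cst// mul0r subrr. Qed.

Lemma cone_rew t : 0 <= t -> constraint_cone (fun x => t * (r x - d)).
Proof.
move=> t0; exists t, (cst 0), [::]; split=> //.
- by move=> s; exact: cvg_cst.
- exact: (bounded_on_cst _ 0).
- by apply/funext => x; rewrite L0star0 big_nil !addr0.
Qed.

Lemma cone_negpart eta : a <= eta <= b ->
  constraint_cone (fun x => negpart (z x - eta) - y eta).
Proof.
move=> aeb; exists 0, (cst 0), [:: (1, eta)]; split=> //.
- by move=> s; exact: cvg_cst.
- exact: (bounded_on_cst _ 0).
- by move=> p; rewrite inE => /eqP ->.
- by apply/funext => x; rewrite L0star0 big_seq1 mul0r !add0r mul1r.
Qed.

Lemma constraint_cone_convex : convex_cone constraint_cone.
Proof.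
split.
- rewrite (_ : (fun=> 0) = (fun x => 0 * (r x - d))); first exact: cone_rew.
  by apply/funext => x; rewrite mul0r.
- move=> _ _ [t1 [h1 [s1 [t10 ch1 bh1 w1 ->]]]] [t2 [h2 [s2 [t20 ch2 bh2 w2 ->]]]].
  exists (t1 + t2), (fun s => h1 s + h2 s), (s1 ++ s2); split.
  + exact: addr_ge0.
  + by move=> s; apply: continuousD; [exact: ch1|exact: ch2].
  + exact: bounded_onD.
  + by move=> p; rewrite mem_cat => /orP[/w1|/w2].
  + by apply/funext => x; rewrite L0starD// big_cat/=; ring.
- move=> c _ c0 [t [h [s [t0 ch bh w ->]]]].
  exists (c * t), (fun u => c * h u), [seq (c * p.1, p.2) | p <- s]; split.
  + exact: mulr_ge0.
  + exact: continuous_scale.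
  + exact: bounded_onZ.
  + by move=> p /mapP[q /w[q0 aqb] ->]; split=> //; exact: mulr_ge0.
  + apply/funext => x; rewrite L0starZ// big_map.
    under [in RHS]eq_bigr do rewrite -mulrA.
    by rewrite -big_distrr/=; ring.
Qed.

Lemma continuous_bounded_Fspace (h : S -> R) : continuous h -> bounded_on setT h ->
  Fspace setT (what M) h.
Proof.
move=> ch [C hC]; split; first exact: borelSpace_continuous_measurable.
apply: (@wnorm_fin _ _ _ _ _ `|C|) => s _; first exact: (what_gt0 HM).
apply: le_trans (hC s I) _; apply: le_trans (ler_norm C) _.
by rewrite ler_peMr// (what_ge1 HM).
Qed.

(* If g <= - e, then (N g + r) / (1 + N t) gives a dual feasible point of value
   less than d for N large: since r <= 0, adding r makes the coefficient of r
   positive even when t = 0. *)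
Lemma constraint_cone_not_neg g e : constraint_cone g -> 0 < e ->
  ~ (forall x, K x -> g x <= - e).
Proof.
move=> [t [h [s [t0 ch bh w ->]]]] e0 gneg.
(* N is chosen so that - N e < d, which is equivalent to (N t d - N e) / T < d for T = 1 + N t. *)
pose N := (`|d| + 1) / e.
have N0 : 0 < N by rewrite divr_gt0// ltr_wpDl.
have Ne : - (N * e) < d.
  by rewrite /N divfK ?gt_eqF//; have := ler_norm (- d); rewrite normrN; lra.
pose T := 1 + N * t; have T0 : 0 < T by rewrite ltr_pwDl// mulr_ge0// ltW.
pose c := N / T; have c0 : 0 <= c by rewrite divr_ge0// ltW.
pose s' := [seq (c * p.1, p.2) | p <- s].
have [|la [laE laf]] := @discrete_measure R `[a, b]%classic s' (measurable_itv _).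
  by move=> p /mapP[q /w[q0 aqb] ->]; split; [exact: mulr_ge0|rewrite /= in_itv].
have {}laf f : continuous f ->
    \int[la]_(x in `[a, b]) f x = c * \sum_(p <- s) p.1 * f p.2.
  move=> cf; rewrite laf; last 2 first.
  - exact: continuous_measurable_fun.
  - exact: continuous_bnd_itv.
  by rewrite big_map big_distrr; apply: eq_bigr => p _; rewrite /= mulrA.
pose sy := \sum_(p <- s) p.1 * y p.2.
(* The term [c * sy] compensates the constants y(eta_i) in the cone element and cancels against the
   integral of y in the objective. *)
pose v := @DualPoint R dS S (fun u => c * h u)
  ((N * t * d - N * e) / T + c * sy) (charge_of_finite_measure la).
have vf : dual_feasible M a b v.
  split=> /=.
  - apply: continuous_bounded_Fspace; last exact: bounded_onZ.
    exact: continuous_scale.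
  - move=> B mB Bab; apply/eqP; rewrite eq_le measure_ge0 andbT -[leRHS]laE.
    apply: le_measure; rewrite ?inE//; first exact: measurableC.
    by apply/disjoints_subset.
  - exact: charge_of_finite_measure_ge0.
  - move=> x Kx.
    rewrite L0starZ// /L1star cintegral_charge_of_finite_measure laf; last first.
      exact: (@continuous_negpartBr R (z x)).
    have := gneg x Kx; set L := L0star M h x.
    under eq_bigr do rewrite mulrBr.
    rewrite sumrB -/sy; set sz := \sum_(p <- s) _ => gx.
    have r0 : r x <= 0 by exact: (rew_le0 HM).
    have -> : r x + c * L - ((N * t * d - N * e) / T + c * sy) + c * sz =
        (r x + N * (t * (r x - d) + L + (sz - sy) + e)) / T.
      by rewrite /c /T; field; rewrite gt_eqF.
    rewrite pmulr_lle0 ?invr_gt0//.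
    have : N * (t * (r x - d) + L + (sz - sy) + e) <= 0.
      by rewrite pmulr_rle0//; lra.
    by lra.
have := d_le vf; rewrite /dual_objective /= cintegral_charge_of_finite_measure laf//.
rewrite -/sy addrK ler_pdivlMr// /T mulrDr mulr1.
by have := Ne; lra.
Qed.

(** A small multiple t (r - d) works: it is at most - t d <= e where r >= - rho, and r < - rho = -
    |d| - 1/t makes it at most - 1. *)
Lemma constraint_cone_tight (e : R) : 0 < e -> exists C g,
  [/\ compact C, constraint_cone g & forall x, K x -> g x <= e - 1 + \1_C x].
Proof.
move=> e0; pose t := e / (`|d| + 1).
have d1 : 0 < `|d| + 1 by rewrite ltr_wpDl.
have t0 : 0 < t by rewrite divr_gt0.
have td : t * (- d) <= e.
  rewrite -[leRHS](divfK (lt0r_neq0 d1)).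
  by rewrite ler_wpM2l// ?(ltW t0)//; have := ler_norm (- d); rewrite normrN; lra.
pose rho := `|d| + t^-1.
have rho0 : 0 <= rho by rewrite addr_ge0// invr_ge0 ltW.
exists [set x | K x /\ - rho <= r x], (fun x => t * (r x - d)); split.
- exact: (rew_compact HM).
- exact/cone_rew/ltW.
- move=> x Kx; rewrite indicE.
  have r0 : r x <= 0 by exact: (rew_le0 HM).
  have [h|h] := leP (- rho) (r x).
    rewrite mem_set//= subrK; apply: le_trans td.
    by rewrite ler_wpM2l ?(ltW t0)//; lra.
  rewrite memNset/= ?addr0; last by move=> [_]; rewrite leNgt h.
  apply: le_trans (_ : - 1 <= _); last lra.
  apply: le_trans (_ : t * (- t^-1) <= _); last by rewrite mulrN mulfV ?gt_eqF.
  rewrite ler_wpM2l ?(ltW t0)//; move: h; rewrite /rho.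
  by have := ler_norm (- d); rewrite normrN; lra.
Qed.

(** Upper semicontinuity of r comes from its compact superlevel sets, closed in a Hausdorff space;
    for c > 0 they are empty as r <= 0. *)
Lemma closed_superlevel_rew c : closed (K `&` [set x | c <= r x]).
Proof.
have [c0|c0] := leP c 0.
  apply: compact_closed; first exact: borelSpace_prod_hausdorff.
  have := rew_compact HM (e := - c); rewrite oppr_ge0 opprK => /(_ c0).
  by congr compact.
rewrite (_ : _ `&` _ = set0); first exact: closed0.
apply/seteqP; split=> // x [Kx /= cr].
by have := rew_le0 HM Kx; rewrite leNgt (lt_le_trans c0 cr).
Qed.

Lemma closed_superlevel_max_rew N c :
  closed (K `&` [set x | c <= Num.max (r x) N]).
Proof.
have [cN|Nc] := leP c N.
  rewrite (_ : _ `&` _ = K); first exact: K_closed.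
  by apply/seteqP; split=> [x []|x Kx] //; split=> //=; rewrite le_max cN orbT.
rewrite (_ : _ `&` _ = K `&` [set x | c <= r x]); first exact: closed_superlevel_rew.
by apply/seteqP; split=> x [Kx] /=; rewrite le_max (leNgt c N) Nc orbF.
Qed.

Lemma closed_superlevel_negpart eta c :
  closed (K `&` [set x | c <= negpart (z x - eta)]).
Proof.
have [c0|c0] := leP c 0; last first.
  rewrite (_ : _ `&` _ = set0); first exact: closed0.
  apply/seteqP; split=> // x [_ /= h].
  by have := negpart_le0 (z x - eta); rewrite leNgt (lt_le_trans c0 h).
rewrite (_ : _ `&` _ = K `&` [set x | c + eta <= z x]).
  by apply: usc_closed_superlevel; [exact: K_closed|exact: (zf_usc HM)].
by apply/seteqP; split=> x [Kx] /=; rewrite /negpart le_min c0 andbT lerBrDr.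
Qed.

Lemma closed_superlevelB (f : S * A -> R) c0 :
  (forall c, closed (K `&` [set x | c <= f x])) ->
  forall c, closed (K `&` [set x | c <= f x - c0]).
Proof.
move=> cf c; rewrite (_ : _ `&` _ = K `&` [set x | c + c0 <= f x]) //.
by apply/seteqP; split=> x [Kx] /=; rewrite lerBrDr.
Qed.

Lemma closed_superlevel_L0star h c : continuous h -> bounded_on setT h ->
  closed (K `&` [set x | c <= L0star M h x]).
Proof.
move=> ch bh; have [_ cQ] := Q_weakly_continuous HM ch bh.
apply: usc_closed_superlevel; first exact: K_closed.
apply: within_continuous_usc => x; apply: (@continuousB _ _ (subspace K)).
  apply: continuous_subspaceT => {}x; apply: continuous_comp; last exact: ch.
  exact: cvg_fst.
exact: cQ.
Qed.

Lemma bounded_on_L0star h : continuous h -> bounded_on setT h -> bounded_on K (L0star M h).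
Proof.
move=> ch bh; have [bQ _] := Q_weakly_continuous HM ch bh.
have bh1 : bounded_on K (fun x => h x.1) by have [C hC] := bh; exists C => x _; exact: hC.
have [C hC] := bounded_onD bh1 (bounded_onZ (-1) bQ).
by exists C => x Kx; have := hC x Kx; rewrite mulN1r.
Qed.

Lemma primal_point_exists :
  exists mu, primal_feasible M a b y mu /\ d <= primal_objective M mu.
Proof.
have [P [PK Pcone]] := moment_probability (@K_closed _ _ _ _ _ M)
  constraint_cone_convex constraint_cone_not_neg constraint_cone_tight.
have zint eta : P.-integrable K (EFin \o (fun x => negpart (z x - eta))).
  by apply: integrable_negpart => //; [exact: zf_measurable|exact: (zf_bounded HM)].
have Pz eta : a <= eta <= b -> y eta <= \int[P]_(x in K) negpart (z x - eta).
  move=> aeb; pose f x := negpart (z x - eta) - y eta.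
  have : 0 <= \int[P]_(x in K) f x.
    apply: (Pcone f f) => //; last 2 first.
    - exact: cone_negpart.
    - exact: (@closed_superlevelB (fun x => negpart (z x - eta)) (y eta)
        (@closed_superlevel_negpart eta)).
    apply: bounded_onD; last exact: bounded_on_cst.
    by apply: bounded_on_negpart; exact: (zf_bounded HM).
  rewrite RintegralB//; last exact: (finite_measure_integrable_cst P (y eta) mK).
  by rewrite Rintegral_cst// (congr1 fine PK) mulr1 subr_ge0.
have PL h : continuous h -> bounded_on setT h -> 0 <= \int[P]_(x in K) L0star M h x.
  move=> ch bh; apply: (Pcone _ (L0star M h)) => //.
  - exact: bounded_on_L0star.
  - exact: L0star_cone.
  - by move=> c; exact: closed_superlevel_L0star.
have Pbal h : continuous h -> bounded_on setT h ->
    \int[P]_(x in K) h x.1 = \int[P]_(x in K) \int[Q x]_s h s.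
  move=> ch bh; have [bQ _] := Q_weakly_continuous HM ch bh.
  (* Applying [PL] to - h gives the reverse inequality, hence equality. *)
  have ch' : continuous (fun s => -1 * h s) by exact: continuous_scale.
  have iL : P.-integrable K (EFin \o L0star M h).
    apply: (bounded_on_integrable P mK) => //; last exact: bounded_on_L0star.
    apply: (@closed_superlevel_measurable _ _ _ _ _ K) => c.
    exact: closed_superlevel_L0star.
  have ih : P.-integrable K (EFin \o (fun x => h x.1)).
    apply: (bounded_on_integrable P mK); last by have [C hC] := bh; exists C => x _; exact: hC.
    apply: measurable_funTS; apply: measurableT_comp; last exact: measurable_fst.
    exact: borelSpace_continuous_measurable.
  have iQ : P.-integrable K (EFin \o (fun x => \int[Q x]_s h s)).
    apply: eq_integrable (integrableB mK ih iL) => // x _ /=.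
    by rewrite -EFinB /L0star opprB addrC subrK.
  apply/eqP; rewrite -subr_eq0 -RintegralB//; apply/eqP.
  apply/eqP; rewrite eq_le PL// andbT -oppr_ge0.
  rewrite -[leRHS]mulN1r -RintegralZl//.
  have := PL _ ch' (bounded_onZ (-1) bh).
  by congr (0 <= _); apply: eq_Rintegral => x _; rewrite L0starZ.
have mr : measurable_fun K r := @rew_measurable _ _ _ _ _ M.
have bal := balance_measurable PK Pbal.
(* The truncation is bounded and lies above r, so r - d in the cone transfers to it. *)
have Pr (N : R) : d <= \int[P]_(x in K) Num.max (r x) N.
  have bN : bounded_on K (fun x => Num.max (r x) N).
    exists `|N| => x Kx; have r0 := rew_le0 HM Kx.
    have [rN|Nr] := leP (r x) N; first by [].
    by rewrite ler0_norm// ler0_norm ?lerN2 ?(ltW Nr)// (le_trans (ltW Nr)).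
  have : 0 <= \int[P]_(x in K) (Num.max (r x) N - d).
    apply: (Pcone _ (fun x => 1 * (r x - d))).
    - by apply: bounded_onD => //; exact: bounded_on_cst.
    - exact: cone_rew.
    - by move=> x Kx; rewrite mul1r lerD2r le_max lexx.
    - exact: (@closed_superlevelB (fun x => Num.max (r x) N) d
        (@closed_superlevel_max_rew N)).
  rewrite RintegralB//; last 2 first.
  - apply: (bounded_on_integrable P mK) => //.
    exact: (measurable_maxr mr (@measurable_cst _ _ _ _ K N)).
  - exact: (finite_measure_integrable_cst P d mK).
  by rewrite Rintegral_cst// (congr1 fine PK) mulr1 subr_ge0.
(* Monotone convergence along N = - n gives the value bound and, at the same time, the integrability
   of r and of the weight. *)
have intr : (\int[P]_(x in K) (- r x)%:E <= (- d)%:E)%E.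
  pose g (n : nat) x := (Num.min (- r x) n%:R)%:E.
  have gN n x : g n x = (- Num.max (r x) (- n%:R))%:E by rewrite /g oppr_max opprK.
  have mg n : measurable_fun K (g n).
    apply/measurable_EFinP; apply: (measurable_minr _ (@measurable_cst _ _ _ _ K (n%:R : R))).
    exact: measurable_funN.
  have g0 n x : K x -> (0 <= g n x)%E.
    by move=> Kx; rewrite lee_fin le_min ler0n oppr_ge0 (rew_le0 HM).
  have gnd x : K x -> {homo g ^~ x : m n / (m <= n)%N >-> (m <= n)%E}.
    move=> Kx m n mn; rewrite lee_fin le_min !ge_min lexx /=.
    by rewrite ler_nat mn orbT.
  have glim x : K x -> limn (g ^~ x) = (- r x)%:E.
    move=> Kx; apply/cvg_lim => //; apply: cvg_near_cst.
    exists (Num.bound (- r x)) => // n /= bn.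
    rewrite /g min_l//; apply: le_trans (ltW (archi_boundP _)) _.
      by rewrite oppr_ge0 (rew_le0 HM).
    by rewrite ler_nat.
  rewrite -(@eq_integral _ _ _ P K (fun x => (- r x)%:E) (fun x => limn (g ^~ x))); last first.
    by move=> x /set_mem Kx; rewrite glim.
  rewrite monotone_convergence//; apply: lime_le.
    apply: ereal_nondecreasing_is_cvgn => m n mn; apply: ge0_le_integral => //.
    + by move=> x Kx; exact: g0.
    + by move=> x Kx; exact: gnd.
  apply: nearW => n.
  have im : P.-integrable K (EFin \o (fun x => Num.max (r x) (- n%:R))).
    apply: (bounded_on_integrable P mK) => //.
      exact: (measurable_maxr mr (@measurable_cst _ _ _ _ K (- n%:R : R))).
    exists n%:R => x Kx; have r0 := rew_le0 HM Kx.
    have n0 : 0 <= (n%:R : R) by [].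
    by rewrite ler_norml le_max lexx orbT ge_max; apply/andP; split=> //; apply/andP; split; lra.
  have -> : (\int[P]_(x in K) g n x =
      \int[P]_(x in K) (- (Num.max (r x) (- n%:R))%:E))%E.
    by apply: eq_integral => x _; rewrite gN EFinN.
  rewrite integralN; last exact: integrable_add_def.
  by rewrite -EFin_Rintegral// -EFinN lee_fin lerN2.
have iNr : P.-integrable K (EFin \o (fun x => - r x)).
  apply/integrableP; split; first by apply/measurable_EFinP; exact: measurable_funN.
  rewrite (eq_integral (fun x => (- r x)%:E)); last first.
    by move=> x /set_mem Kx /=; rewrite ger0_norm// oppr_ge0 (rew_le0 HM).
  exact: le_lt_trans intr (ltry _).
have iw : P.-integrable K (EFin \o weight M).
  exact: (integrableD mK (finite_measure_integrable_cst P 1 mK) iNr).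
exists (charge_of_finite_measure P); split; last first.
  rewrite /primal_objective /pairing cintegral_charge_of_finite_measure.
  have : (\int[P]_(x in K) - r x) <= - d by rewrite -lee_fin EFin_Rintegral.
  rewrite (@eq_Rintegral _ _ _ P K (fun x => -1 * r x)); last by move=> x _; rewrite mulN1r.
  have ir : P.-integrable K (EFin \o r).
    have iNN := integrableN iNr.
    by apply: eq_integrable iNN => // x _ /=; rewrite opprK.
  rewrite RintegralZl//.
  by rewrite mulN1r lerN2.
split.
- split.
    move=> B mB BK; apply/eqP; rewrite eq_le measure_ge0 andbT.
    rewrite -[leRHS](probability_conull PK); apply: le_measure; rewrite ?inE//.
      exact: measurableC.
    by apply/disjoints_subset.
  rewrite integral_total_variation_charge_of_finite_measure.
  rewrite (eq_integral (fun x => `|(weight M x)%:E|)%E); last first.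
    move=> x /set_mem Kx; rewrite /= ger0_norm// ltW//.
    exact: (weight_gt0 HM).
  by move/integrableP : iw => [].
- exact: charge_of_finite_measure_ge0.
- move=> B mB; rewrite /L0 /pairing cintegral_charge_of_finite_measure.
  apply/eqP; rewrite subr_eq0; apply/eqP.
  rewrite [X in fine X](bal B mB) /Rintegral; congr fine.
  by apply: eq_integral => x _; rewrite fineK//; exact: fin_num_measure.
- rewrite /pairing cintegral_charge_of_finite_measure Rintegral_cst//.
  by rewrite (congr1 fine PK) mulr1.
- by move=> eta aeb; rewrite /L1 /pairing cintegral_charge_of_finite_measure Pz.
Qed.

End PrimalExistence.

(** * Compactness of bounded dual sequences *)

Section Diagonal.
Context {R : realType}.

(** Compactness gives a cluster point, and a cluster point of an ultrafilter is a limit: the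
    preimage of a neighbourhood or its complement is large, and the complement is excluded by
    clustering. *)
Lemma ultra_bounded_cvg (G : set_system nat) (u : nat -> R) (C : R) :
  UltraFilter G -> (forall n, `|u n| <= C) -> exists l : R, u @ G --> l.
Proof.
move=> GU uC; have GP : ProperFilter G by exact: ultra_proper.
have [l [_ ul]] : `[- C, C] `&` cluster (u @ G) !=set0.
  apply: (@segment_compact R (- C) C).
  by apply: nearW => n; rewrite /= in_itv/= -ler_norml.
exists l => B Bl; have [//|GB] := in_ultra_setVsetC (u @^-1` B) GU.
have GA : G (u @^-1` (u @` (~` (u @^-1` B)))).
  by apply: filterS GB => n nB; exists n.
have [] := ul (u @` (~` (u @^-1` B))) B GA Bl.
by move=> _ [[n nB <-] uB].
Qed.

(* The limits are taken along a free ultrafilter, and a subsequence is read off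
   from its members. *)
Lemma bounded_diagonal (x : nat -> nat -> R) :
  (forall j, exists C, forall n, `|x n j| <= C) ->
  exists (phi : nat -> nat) (l : nat -> R),
    (forall k, (k <= phi k)%N) /\ forall j, x (phi k) j @[k --> \oo] --> l j.
Proof.
move=> xC; have [G [GU ooG]] := ultraFilterLemma (eventually_filter).
have GP : ProperFilter G by exact: ultra_proper.
have [l xl] : {l : nat -> R & forall j, (x ^~ j) @ G --> l j}.
  apply: (@choice _ _ (fun j (l : R) => (x ^~ j) @ G --> l)) => j.
  by have [C hC] := xC j; exact: ultra_bounded_cvg hC.
(* Only coordinates up to k are controlled at stage k, a finite intersection of large sets; freeness
   of G allows k <= phi k. *)
have [phi phiP] : {phi : nat -> nat & forall k, (k <= phi k)%N /\
    forall j, (j <= k)%N -> `|l j - x (phi k) j| < k.+1%:R^-1}.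
  apply: (@choice _ _ (fun k n => (k <= n)%N /\
    forall j, (j <= k)%N -> `|l j - x n j| < k.+1%:R^-1)) => k.
  apply: (@filter_ex _ G); apply: filterI; first by apply: ooG; exists k.
  have near1 j : G [set n | `|l j - x n j| < k.+1%:R^-1].
    have /cvgrPdist_lt/(_ k.+1%:R^-1) := xl j.
    by apply; rewrite invr_gt0.
  suff h m : G [set n | forall j, (j < m)%N -> `|l j - x n j| < k.+1%:R^-1].
    by apply: filterS (h k.+1) => n hn j jk; apply: hn.
  elim: m => [|m ih]; first by apply: filterS filterT => n _ j.
  apply: filterS (filterI ih (near1 m)) => n [h1 h2] j.
  by rewrite ltnS leq_eqVlt => /predU1P[->//|/h1].
exists phi, l; split=> [k|j]; first by have [] := phiP k.
apply/cvgrPdist_lt => e e0; exists (maxn j (Num.bound e^-1)) => // k /=.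
rewrite geq_max => /andP[jk bk]; have [_ /(_ j jk)] := phiP k.
move/lt_trans; apply; rewrite invf_plt ?posrE//.
apply: lt_le_trans (archi_boundP _) _; first by rewrite invr_ge0 ltW.
by rewrite ler_nat (leq_trans bk).
Qed.

End Diagonal.

Lemma measurable_sigma_open {R : realType} (B : set R) :
  measurable B -> <<s @open R >> B.
Proof.
move=> mB; have : (@ocitv R).-sigma.-measurable B by exact: mB.
rewrite RGenOpens.measurableE; apply: smallest_sub.
  exact: smallest_sigma_algebra.
by move=> _ [x [x' ->]]; apply: sub_sigma_algebra; exact: interval_open.
Qed.

Section WeakStarLimit.
Context {R : realType} (a b : R).
Variables (la : nat -> {finite_measure set R -> \bar R}) (m : R).
Local Notation E := (`[a, b]%classic : set R).
Local Notation int n g := (\int[la n]_(x in E) g x).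
Hypothesis mass : fine (la n E) @[n --> \oo] --> m.

Let mE : measurable E. Proof. exact: measurable_itv. Qed.

Let cone : set (R -> R) :=
  [set g | continuous g /\ int n g @[n --> \oo] --> (0 : R)].

Let icont n g : continuous g -> (la n).-integrable E (EFin \o g).
Proof. exact: continuous_integrable_itv. Qed.

Let cone_scale c f : cone f -> cone (fun x => c * f x).
Proof.
move=> [cf f0]; split; first exact: continuous_scale.
under eq_fun do rewrite RintegralZl ?icont//.
by rewrite -[0](mulr0 c); apply: cvgM => //; exact: cvg_cst.
Qed.

Let cone_convex : convex_cone cone.
Proof.
split.
- split; first by move=> x; exact: cvg_cst.
  under eq_fun do rewrite Rintegral_cst// mul0r.
  exact: cvg_cst.
- move=> f g [cf f0] [cg g0]; split.
    by move=> x; apply: continuousD; [exact: cf|exact: cg].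
  under eq_fun do rewrite RintegralD ?icont//.
  by rewrite -[0]addr0; exact: cvgD.
- by move=> c f _; exact: cone_scale.
Qed.

Let cone_not_neg g e : 0 < m -> cone g -> 0 < e ->
  ~ (forall x, E x -> g x <= - e).
Proof.
move=> m0 [cg g0] e0 ge.
have : 0 <= - e * m.
  have emass : - e * fine (la n E) @[n --> \oo] --> - e * m.
    by apply: cvgM => //; exact: cvg_cst.
  rewrite -(cvg_lim (@Rhausdorff R) g0) -(cvg_lim (@Rhausdorff R) emass).
  apply: ler_lim; [by apply/cvg_ex; exists 0|by apply/cvg_ex; exists (- e * m)|].
  apply: nearW => n; rewrite -Rintegral_cst//; apply: le_Rintegral => //.
    exact: icont.
  by apply: icont => x; exact: cvg_cst.
by rewrite mulNr oppr_ge0 leNgt mulr_gt0.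
Qed.

Let closed_superlevel (g : R -> R) (c : R) : continuous g ->
  closed (E `&` [set x : R | c <= g x]).
Proof.
move=> cg; apply: closedI; first exact: interval_closed.
rewrite (_ : [set x : R | _] = g @^-1` [set t : R | c <= t]) //.
by apply: closed_comp; [move=> x _; exact: cg|exact: closed_ge].
Qed.

Let closed_measurable_set (F : set R) : closed F -> measurable F.
Proof. exact: closed_measurable. Qed.

(* The functions whose integrals against [la n] tend to 0 are a cone to which the
   argument of [moment_probability] applies. *)
Let positive_case : 0 < m -> exists P : probability R R, P E = 1%E /\
  forall g, cone g -> \int[P]_(x in E) g x = 0.
Proof.
move=> m0.
have tight (e : R) : 0 < e -> exists C g, [/\ compact C, cone g &
    forall x, E x -> g x <= e - 1 + \1_C x].
  move=> e0; exists E, (fun=> 0); split; first exact: segment_compact.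
    by have [] := cone_convex.
  by move=> x Ex; rewrite indicE mem_set// subrK ltW.
have [l [mu [pl lG car mu1 lmu]]] := @cone_outer_measure R R E cone
  (@Rhausdorff R) cone_convex (fun g e => @cone_not_neg g e m0) tight.
have [P PE] : exists P : probability R R, forall B, P B = mu B.
  apply: outer_measure_probability => // B mB.
  by apply: car; exact: measurable_sigma_open.
have cE : closed E by exact: interval_closed.
have PE1 : P E = 1%E.
  suff h : (1 <= mu E)%E.
    by apply/eqP; rewrite eq_le probability_le1//=; move: h; rewrite -PE.
  apply: le_trans (lmu _ cE); rewrite lee_fin -(pf1 pl); apply: pf_le pl _ _ _ => //.
  - exact: (bounded_on_cst E 1).
  - exact: bounded_on_indic.
  - by move=> x Ex; rewrite indicE mem_set.
have ge0 g : cone g -> 0 <= \int[P]_(x in E) g x.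
  move=> Gg; have [cg _] := Gg; have bg := @continuous_bnd_itv _ a b _ cg.
  apply: le_trans (lG g g bg Gg _) _ => //.
  apply: positive_functional_le_Rintegral => //.
    by apply: measurable_funTS; exact: continuous_measurable_fun.
  move=> c; have cF : closed (E `&` [set x | c <= g x]) by exact: closed_superlevel.
  have := lmu _ cF; rewrite -PE -lee_fin fineK//.
  by apply: fin_num_measure; exact: closed_measurable_set.
exists P; split=> // g Gg; apply/eqP; rewrite eq_le ge0// andbT.
have [cg _] := Gg; have := ge0 _ (cone_scale (-1) Gg); rewrite RintegralZl//.
  by rewrite mulN1r oppr_ge0.
exact: (@continuous_integrable_itv _ a b P g cg).
Qed.

(** For m > 0 the limit is m times the probability of [positive_case]. For m = 0 the masses vanish
    in the limit, so integrals of continuous functions tend to 0 and the zero measure works. *)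
Lemma weak_star_limit : exists L : {finite_measure set R -> \bar R},
  L (~` E) = 0%E /\ forall g c, continuous g ->
    int n g @[n --> \oo] --> c -> \int[L]_(x in E) g x = c.
Proof.
have m0 : 0 <= m.
  rewrite -(cvg_lim (@Rhausdorff R) mass); apply: limr_ge.
    by apply/cvg_ex; exists m.
  by apply: nearW => n; rewrite fine_ge0.
move: m0; rewrite [X in is_true X -> _]le_eqVlt => /predU1P[m0|m0]; last first.
  have [P [PE Pcone]] := positive_case m0.
  pose c0 : {nonneg R} := NngNum (ltW m0).
  exists (mscale c0 P); split.
    have PEC : P (~` E) = 0%E.
      by rewrite [LHS](probability_setC P mE) [X in (_ - X)%E]PE subee.
    by rewrite [LHS](_ : _ = m%:E * P (~` E))%E// PEC mule0.
  move=> g c cg gc; have Pint f : continuous f -> P.-integrable E (EFin \o f).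
    by move=> cf; exact: (@continuous_integrable_itv _ a b P f cf).
  rewrite (Rintegral_mscale c0 mE (Pint g cg)).
  have cc : continuous (fun _ : R => c / m) by move=> x; exact: cvg_cst.
  (* The integrals of g - c/m tend to c - (c/m) m = 0. *)
  have /Pcone : cone (fun x => g x - c / m).
    split; first by move=> x; exact: cvgB (cg x) (cc x).
    under eq_fun => n.
      rewrite (RintegralB mE (icont n cg) (icont n cc)) Rintegral_cst//.
      over.
    rewrite -(subrr c) -[X in c - X](divfK (lt0r_neq0 m0)).
    apply: cvgB => //; apply: cvgM => //; exact: cvg_cst.
  rewrite (RintegralB mE (Pint g cg) (Pint _ cc)).
  rewrite Rintegral_cst// (congr1 fine PE) mulr1 => /eqP; rewrite subr_eq0 => /eqP ->.
  by rewrite /= mulrC divfK// lt0r_neq0.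
exists mzero; split=> // g c cg gc.
rewrite /Rintegral integral_measure_zero/=.
have [C gC] := continuous_bnd_itv a b cg.
have h0 : `|C| * fine (la n E) @[n --> \oo] --> (0 : R).
  by rewrite -[0](mulr0 `|C|) [X in _ * X]m0; apply: cvgM => //; exact: cvg_cst.
apply/esym; apply: (cvg_unique (@Rhausdorff R) gc).
apply/norm_cvg0P; apply: (squeeze_cvgr _ (cvg_cst 0) h0).
apply: nearW => n; rewrite normr_ge0/=.
apply: le_trans (le_normr_Rintegral mE (icont n cg)) _.
rewrite -Rintegral_cst//; apply: le_Rintegral => //.
- exact: (integrable_abse (icont n cg)).
- exact: (finite_measure_integrable_cst (la n) `|C| mE).
- by move=> x Ex; exact: le_trans (gC x Ex) (ler_norm C).
Qed.

End WeakStarLimit.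

(** * Limits superior and the reverse Fatou lemma *)

Section Limsup.
Context {R : realType}.
Implicit Types u v : (\bar R)^nat.

Lemma limn_esup_shift u l : l \is a fin_num ->
  limn_esup (fun n => l + u n)%E = (l + limn_esup u)%E.
Proof.
move=> lfin; apply: oppe_inj; rewrite -limn_einfN oppeD ?fin_num_adde_defr//.
rewrite -limn_einfN -limn_einf_shift ?fin_numN//; congr limn_einf.
by apply/funext => n /=; rewrite oppeD ?fin_num_adde_defr.
Qed.

Lemma limn_esup_near_le u v : (\forall n \near \oo, (u n <= v n)%E) ->
  (limn_esup u <= limn_esup v)%E.
Proof.
move=> [N _ uv]; rewrite !limn_esup_lim; apply: lee_lim; try exact: is_cvg_esups.
exists N => // n /= Nn; apply: ge_ereal_sup => _ [k /= nk <-].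
apply: le_trans (uv k (leq_trans Nn nk)) _.
by apply: ereal_sup_ubound; exists k.
Qed.

End Limsup.

Section LimsupFatou.
Context {R : realType} d {T : measurableType d}.
Variables (h : nat -> T -> R) (w : T -> R).
Hypotheses (mh : forall n, measurable_fun setT (h n))
  (mw : measurable_fun setT w) (hw : forall n x, `|h n x| <= w x).

Definition limsup_fun (x : T) : R := fine (limn_esup (fun n => (h n x)%:E)).

Let esup_itv x : (- (w x)%:E <= limn_esup (fun n => (h n x)%:E) <= (w x)%:E)%E.
Proof.
have cw (c : R) : limn_esup (fun=> c%:E) = c%:E.
  by rewrite (is_cvg_limn_esupE (is_cvg_cst _)) lim_cst.
rewrite -EFinN -[X in (X <= _)%E]cw -[X in (_ <= _ <= X)%E]cw.
apply/andP; split; apply: limn_esup_near_le; apply: nearW => n; rewrite lee_fin;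
  by have := hw n x; rewrite ler_norml => /andP[].
Qed.

Lemma limsup_funE x : (limsup_fun x)%:E = limn_esup (fun n => (h n x)%:E).
Proof.
rewrite fineK// fin_numE; have /andP[h1 h2] := esup_itv x.
apply/andP; split; first by rewrite gt_eqF// (lt_le_trans _ h1)// -EFinN ltNyr.
by rewrite lt_eqF// (le_lt_trans h2)// ltry.
Qed.

Lemma limsup_fun_le x : `|limsup_fun x| <= w x.
Proof. by rewrite ler_norml -!lee_fin EFinN limsup_funE esup_itv. Qed.

Lemma measurable_limsup_fun : measurable_fun setT limsup_fun.
Proof.
apply/measurable_EFinP.
rewrite (_ : EFin \o _ = fun x => limn_esup (fun n => (h n x)%:E)); last first.
  by apply/funext => x /=; rewrite limsup_funE.
by apply: measurable_fun_limn_esup => n; apply/measurable_EFinP.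
Qed.

Variable P : {measure set T -> \bar R}.
Hypothesis iw : P.-integrable setT (EFin \o w).

Let ih (f : T -> R) : measurable_fun setT f -> (forall x, `|f x| <= w x) ->
  P.-integrable setT (EFin \o f).
Proof.
move=> mf fw; apply: le_integrable iw => //; first exact/measurable_EFinP.
by move=> x _ /=; rewrite lee_fin (le_trans (fw x))// ler_norm.
Qed.

(** Fatou's lemma for the nonnegative functions w - h n. *)
Lemma limsup_fatou :
  (limn_esup (fun n => (\int[P]_x h n x)%:E) <= (\int[P]_x limsup_fun x)%:E)%E.
Proof.
have iH := ih measurable_limsup_fun limsup_fun_le.
have ihn n := ih (mh n) (hw n).
have intB f : P.-integrable setT (EFin \o f) ->
    (\int[P]_x (w x - f x)%:E = (\int[P]_x w x)%:E + - (\int[P]_x f x)%:E)%E.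
  move=> iF; rewrite -EFinN -EFinD -RintegralB//.
  rewrite EFin_Rintegral//; exact: (integrableB measurableT iw iF).
pose f n x := (w x - h n x)%:E.
have mf n : measurable_fun setT (f n).
  by apply/measurable_EFinP; exact: measurable_funB.
have f0 n x : setT x -> (0 <= f n x)%E.
  by move=> _; rewrite lee_fin subr_ge0 (le_trans (ler_norm _)).
have eL : (\int[P]_x limn_einf (f ^~ x) = \int[P]_x (w x - limsup_fun x)%:E)%E.
  apply: eq_integral => x _; rewrite EFinB limsup_funE -limn_einfN.
  by rewrite -limn_einf_shift.
have eR : (fun n => \int[P]_x f n x)%E =
    (fun n => (\int[P]_x w x)%:E + (-%E \o (fun n => (\int[P]_x h n x)%:E)) n)%E.
  by apply/funext => n; rewrite intB.
have := fatou P measurableT mf f0.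
rewrite eL eR intB// limn_einf_shift// limn_einfN leeD2lE//.
by rewrite leeN2.
Qed.

(** Take limsup on both sides, then apply [limsup_fatou]; the slack e absorbs the difference between
    c n and its limit. *)
Lemma limsup_fatou_le (c : nat -> R) l x : c @ \oo --> l ->
  (forall n, h n x + c n <= \int[P]_t h n t) ->
  limsup_fun x + l <= \int[P]_t limsup_fun t.
Proof.
move=> cl hle; apply/ler_addgt0Pr => e e0.
rewrite -lerBrDr -lee_fin limsup_funE.
have -> : (\int[P]_t limsup_fun t + e - l)%:E =
    ((e - l)%:E + (\int[P]_t limsup_fun t)%:E)%E.
  by rewrite -EFinD; congr EFin; ring.
apply: le_trans (_ : _ <= (e - l)%:E + limn_esup (fun n => (\int[P]_x h n x)%:E))%E _.
  rewrite -limn_esup_shift//; apply: limn_esup_near_le.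
  have /cvgrPdist_lt/(_ e e0) := cl.
  apply: filterS => n /=; rewrite ltr_norml => /andP[h1 h2].
  by rewrite -EFinD lee_fin; have := hle n; lra.
by rewrite leeD2l// limsup_fatou.
Qed.

End LimsupFatou.

(** * Existence of a dual solution *)

Section NegpartTransformOrder.
Context {R : realType} (a b : R) (la : {finite_measure set R -> \bar R}).

Lemma le_negpart_transform t t' : t <= t' ->
  negpart_transform a b la t <= negpart_transform a b la t'.
Proof.
move=> tt'; apply: le_Rintegral => //.
- exact: (@continuous_integrable_itv _ a b la _ (@continuous_negpartBr R t)).
- exact: (@continuous_integrable_itv _ a b la _ (@continuous_negpartBr R t')).
- by move=> eta _; rewrite le_negpart// lerD2r.
Qed.

(** The subsequence controls rational arguments only. Approximation from the left matches
    [le_negpart_transform]: a feasibility bound at t holds a fortiori at each rational q < t, passes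
    to the limit there, and returns to t by the Lipschitz estimate. *)
Lemma negpart_transform_le_rat (t c : R) :
  (forall q : rat, ratr q < t -> negpart_transform a b la (ratr q) <= c) ->
  negpart_transform a b la t <= c.
Proof.
move=> hq; set g := negpart_transform a b la in hq *.
apply/ler_addgt0Pr => e e0; set m := fine (la `[a, b]%classic).
have m0 : 0 <= m by rewrite fine_ge0.
have m1 : 0 < m + 1 by rewrite ltr_wpDl.
have [q] : exists q : rat, ratr q \in `]t - e / (m + 1), t[.
  by apply: rat_in_itvoo; rewrite gtrBl divr_gt0.
rewrite in_itv/= => /andP[q1 q2].
have := negpart_transform_dist a b la t (ratr q); rewrite -/g -/m.
rewrite [`|t - _|]gtr0_norm ?subr_gt0// => h.
have := ler_norm (g t - g (ratr q)); have := hq q q2.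
have : m * (t - ratr q) <= e.
  apply: le_trans (_ : (m + 1) * (e / (m + 1)) <= _).
    by apply: ler_pM => //; lra.
  by rewrite mulrC divfK ?gt_eqF.
lra.
Qed.

End NegpartTransformOrder.

Section DualAttainment.
Context {R : realType} {dS dA} {S : borelSpaceType R dS}
  {A : borelSpaceType R dA} (M : mdp S A) (a b : R) (y : R -> R).
Hypotheses (HM : standing_assumptions M a b y) (cy : continuous y).
Variables (u : nat -> dual_point S) (d : R).
Hypotheses (uf : forall n, dual_feasible M a b (u n))
  (ud : dual_objective a b y (u n) @[n --> \oo] --> d)
  (beta_bounded : exists C : R, forall n, `|dp_beta (u n)| <= C)
  (h_bounded : exists C : R, forall n,
     (wnorm setT (what M) (dp_h (u n)) <= C%:E)%E)
  (Lambda_bounded : weak_star_bounded a b (fun n => dp_Lambda (u n))).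
Local Notation K := (K M).
Local Notation E := (`[a, b]%classic : set R).

Lemma dual_point_exists :
  exists v, dual_feasible M a b v /\ dual_objective a b y v = d.
Proof.
have mE : measurable E by exact: measurable_itv.
have [la laE] : {la : nat -> {finite_measure set R -> \bar R} &
    forall n D f, cintegral (dp_Lambda (u n)) D f = \int[la n]_(t in D) f t}.
  apply: (@choice _ _ (fun n (m : {finite_measure set R -> \bar R}) =>
    forall D f, cintegral (dp_Lambda (u n)) D f = \int[m]_(t in D) f t)) => n.
  have [_ _ L0 _] := uf n.
  by have [m [_ h _]] := charge_ge0_measure L0; exists m.
(* All quantities whose limits are needed, in one sequence: beta, the mass, the integral of y, and
   from index 3 on the transforms at the rationals, with 0 at indices that encode none. *)
pose x n j := match j with
  | 0%N => dp_beta (u n)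
  | 1%N => fine (la n E)
  | 2%N => \int[la n]_(t in E) y t
  | i.+3 => if unpickle i is Some q then
      negpart_transform a b (la n) (ratr (q : rat)) else 0
  end.
have la_bounded f : continuous f ->
    exists C, forall n, `|\int[la n]_(t in E) f t| <= C.
  move=> cf; have [C hC] := Lambda_bounded (continuous_subspaceT cf).
  by exists C => n; rewrite -laE.
have xC j : exists C, forall n, `|x n j| <= C.
  case: j => [//|[|[|i]]]; last 2 first.
  - exact: la_bounded.
  - rewrite /x; case: (unpickle i) => [q|]; last by exists 0 => n; rewrite normr0.
    by apply: la_bounded; exact: continuous_negpartBr.
  have [|C hC] := la_bounded (fun=> 1); first by move=> ?; exact: cvg_cst.
  by exists C => n; have := hC n; rewrite Rintegral_cst// mul1r.
have [phi [l [phik xl]]] := bounded_diagonal xC.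
have [L [LE Lint]] := weak_star_limit (xl 1%N).
have Lq (q : rat) : negpart_transform a b (la (phi k)) (ratr q) @[k --> \oo] -->
    negpart_transform a b L (ratr q).
  have := xl (pickle q).+3; rewrite /x pickleK => xq.
  by rewrite /negpart_transform (Lint _ _ (@continuous_negpartBr R (ratr q)) xq).
have [C hC] := h_bounded.
have what_gt0 s : setT s -> 0 < what M s by move=> _; exact: (what_gt0 HM).
have hw n s : `|dp_h (u n) s| <= C * what M s by exact: (wnorm_le what_gt0 (hC n)).
have mh n : measurable_fun setT (dp_h (u n)) by have [[]] := uf n.
have mw : measurable_fun setT (fun s => C * what M s).
  by apply: measurable_funM => //; exact: measurable_what HM.
pose h k := dp_h (u (phi k)).
have mhk k : measurable_fun setT (h k) by exact: mh.
have hkw k s : `|h k s| <= C * what M s by exact: hw.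
exists (DualPoint (limsup_fun h) (l 0%N) (charge_of_finite_measure L)); split; last first.
  rewrite /dual_objective/= cintegral_charge_of_finite_measure.
  rewrite (Lint _ _ cy (xl 2%N)).
  apply: (cvg_unique (@Rhausdorff R) (cvgB (xl 0%N) (xl 2%N))).
  have phioo : phi k @[k --> \oo] --> \oo.
    move=> B [N _ NB]; exists N => // k /= Nk; apply: NB => /=.
    exact: leq_trans (phik k).
  have := cvg_comp _ _ phioo ud; apply: cvg_trans; apply: near_eq_cvg.
  by apply: nearW => k; rewrite /= /dual_objective laE.
split => /=.
- split; first exact: measurable_limsup_fun mhk hkw.
  apply: (@wnorm_fin _ _ _ _ _ C) => // s _; exact: limsup_fun_le hkw s.
- move=> B mB BE; apply/eqP; rewrite eq_le measure_ge0 andbT.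
  rewrite -[leRHS]LE; apply: le_measure; rewrite ?inE//.
    exact: measurableC.
  by apply/disjoints_subset.
- exact: charge_of_finite_measure_ge0.
- move=> z Kz.
  rewrite (@L1starE _ _ _ _ _ M a b L _ _ (cintegral_charge_of_finite_measure L)).
  (* It remains to prove the inequality with z replaced by a rational q below it, for which the
     transforms converge. *)
  rewrite -lerBrDl sub0r; apply: negpart_transform_le_rat => q qz.
  have iw : (Q M z).-integrable setT (EFin \o (fun s => C * what M s)).
    apply: (integrable_what_bound HM (C := `|C|) Kz mw) => s.
    by rewrite normrM [`|what M s|]gtr0_norm// what_gt0.
  pose c k := rew M z - x (phi k) 0%N + negpart_transform a b (la (phi k)) (ratr q).
  have cl : c k @[k --> \oo] -->
      rew M z - l 0%N + negpart_transform a b L (ratr q).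
    apply: cvgD (Lq q); apply: cvgB (xl 0%N); exact: cvg_cst.
  have := limsup_fatou_le mhk mw hkw iw (x := z.1) cl.
  rewrite /L0star; suff hle n : h n z.1 + c n <= \int[Q M z]_t h n t.
    by move=> /(_ hle); lra.
  have [_ _ _ /(_ z Kz)] := uf (phi n).
  rewrite (L1starE _ _ _ _ (laE _)) /L0star /c /x -/(h n).
  have := le_negpart_transform a b (la (phi n)) (ltW qz); lra.
Qed.

End DualAttainment.

(** * Strong duality *)

(** Makes the dual value finite: the bounds on beta^n and on the integrals of y against Lambda^n
    bound the objectives. *)
Lemma bounded_ereal_limit (R : realType) (c : nat -> R) (C : R) (l : \bar R) :
  (forall n, `|c n| <= C) -> (fun n => (c n)%:E) @ \oo --> l ->
  l \is a fin_num.
Proof.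
move=> cC cl; have e : limn (fun n => (c n)%:E) = l by exact/cvg_lim.
have ic : cvgn (fun n => (c n)%:E) by apply/cvg_ex; exists l.
rewrite fin_numE gt_eqF ?lt_eqF//; rewrite -e.
  apply: le_lt_trans (_ : _ <= C%:E)%E (ltry _); apply: lime_le => //.
  by apply: nearW => n; rewrite lee_fin (le_trans (ler_norm _)).
apply: lt_le_trans (ltNyr (- C)) (_ : _ <= _)%E; apply: lime_ge => //.
by apply: nearW => n; rewrite lee_fin; have := cC n; rewrite ler_norml => /andP[].
Qed.

Theorem theorem4p6 (R : realType) (dS dA dO : measure_display)
    (S : borelSpaceType R dS) (A : borelSpaceType R dA) (M : mdp S A)
    (Om : measurableType dO) (PY : probability Om R) (Y : {RV PY >-> R})
    (a b : R) (Y_supp : PY (Y @^-1` `[a, b]) = 1%E)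
    (HM : standing_assumptions M a b (benchmark Y))
    (u : nat -> dual_point S)
    (u_min : minimizing_sequence M a b (benchmark Y) u)
    (beta_bounded : exists C : R, forall n, `|dp_beta (u n)| <= C)
    (h_bounded : exists C : R, forall n,
        (wnorm setT (what M) (dp_h (u n)) <= C%:E)%E)
    (Lambda_bounded : weak_star_bounded a b (fun n => dp_Lambda (u n))) :
  primal_value M a b (benchmark Y) = dual_value M a b (benchmark Y) /\
  (exists mu, primal_feasible M a b (benchmark Y) mu /\
     (primal_objective M mu)%:E = primal_value M a b (benchmark Y)) /\
  (exists v, dual_feasible M a b v /\
     (dual_objective a b (benchmark Y) v)%:E = dual_value M a b (benchmark Y)).
Proof.
set y := benchmark Y in HM u_min *.
have cy : continuous y by exact: benchmark_continuous Y_supp.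
have [uf ulim] := u_min.
have dfin : dual_value M a b y \is a fin_num.
  have [C1 h1] := beta_bounded.
  have [C2 h2] := Lambda_bounded _ (continuous_subspaceT cy).
  apply: bounded_ereal_limit (C1 + C2) _ _ ulim => n.
  by rewrite (le_trans (ler_normB _ _))// lerD.
pose d := fine (dual_value M a b y).
have dE : dual_value M a b y = d%:E by rewrite fineK.
have d_le v : dual_feasible M a b v -> d <= dual_objective a b y v.
  by move=> fv; rewrite -lee_fin -dE; apply: ereal_inf_lbound; exists v.
have ud : dual_objective a b y (u n) @[n --> \oo] --> d.
  by move: ulim; rewrite dE => /fine_cvg.
have [mu [fmu dmu]] := primal_point_exists HM cy d_le.
have [v [fv vd]] :=
  dual_point_exists HM cy uf ud beta_bounded h_bounded Lambda_bounded.
have pd mu' : primal_feasible M a b y mu' -> primal_objective M mu' <= d.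
  by move=> fmu'; rewrite -vd; exact: (weak_duality HM cy fmu' fv).
have mud : primal_objective M mu = d by apply/le_anti; rewrite pd.
have pE : primal_value M a b y = d%:E.
  apply/le_anti/andP; split.
    by apply: ge_ereal_sup => _ [mu' fmu' <-]; rewrite lee_fin pd.
  by rewrite -mud; apply: ereal_sup_ubound; exists mu.
by rewrite pE dE; split=> //; split; [exists mu; rewrite mud|exists v; rewrite vd].
Qed.
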